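(* Let $\mu\in ID(\mathbb{R})$ be symmetric and not a Dirac measure. Then $\Phi_\mu$ is one-to-one on its Lévy domain $\mathfrak{M}^1_L(\mathbb{R}^+)$: if $\rho,\tilde\rho\in\mathfrak{M}^1_L(\mathbb{R}^+)$ and $\Phi_\mu(\rho)=\Phi_\mu(\tilde\rho)$, then $\rho=\tilde\rho$.
   Context: For $\mu\in ID(\mathbb{R})$ with characteristic exponent $\phi$, $\mu^s$ is the law with characteristic function $e^{s\phi}$. $\mathfrak{M}^1_L(\mathbb{R}^+)$ is the set of measures $\rho$ on $[0,\infty)$ with $\rho(\{0\})=0$ and $\int(1\wedge s)\rho(ds)<\infty$. $\Phi_\mu(\rho)$ is the measure on $\mathbb{R}$ with $\Phi_\mu(\rho)(\{0\})=0$ and $\Phi_\mu(\rho)(A)=\int_0^\infty\mu^s(A)\rho(ds)$ for Borel $A\subseteq\mathbb{R}\setminus\{0\}$. Symmetric means $\mu(-A)=\mu(A)$ for all Borel $A$. *)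

(* Defs.v *)
From mathcomp Require Import all_boot all_algebra.
From mathcomp Require Import all_classical all_reals all_analysis.
From mathcomp Require Import complex.
Import GRing.Theory Num.Theory numFieldNormedType.Exports.

Set Implicit Arguments.
Unset Strict Implicit.
Unset Printing Implicit Defensive.

Local Open Scope classical_set_scope.
Local Open Scope ring_scope.
Local Open Scope complex_scope.

Section LevyDefs.
Context {R : realType}.

(* Characteristic function  t |-> \int e^{itx} mu(dx),  written via its real
   and imaginary parts (both integrands are bounded, hence integrable). *)
Definition charfun (mu : probability R R) (t : R) : complex R :=
  (fine (\int[mu]_x (cos (t * x))%:E))%E +i*
  (fine (\int[mu]_x (sin (t * x))%:E))%E.

Definition expC (z : complex R) : complex R :=
  (expR (complex.Re z) * cos (complex.Im z)) +i*
  (expR (complex.Re z) * sin (complex.Im z)).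

Definition is_convolution (lam nu mu : probability R R) : Prop :=
  forall A : set R, measurable A ->
    mu A = (lam \x nu)%E ((fun p : R * R => p.1 + p.2) @^-1` A).

Inductive convpow (nu : probability R R) : nat -> probability R R -> Prop :=
  | convpow1 : convpow nu 1 nu
  | convpowS n lam mu : convpow nu n lam -> is_convolution lam nu mu ->
      convpow nu n.+1 mu.

Definition infinitely_divisible (mu : probability R R) : Prop :=
  forall n : nat, (0 < n)%N -> exists nu : probability R R, convpow nu n mu.

Definition char_exponent (mu : probability R R) (phi : R -> complex R) : Prop :=
  continuous (fun t : R => complex.Re (phi t)) /\
  continuous (fun t : R => complex.Im (phi t)) /\
  phi 0 = 0 /\ forall t, expC (phi t) = charfun mu t.

Definition is_mpow (mu : probability R R) (s : R) (nu : probability R R) : Prop :=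
  exists phi, char_exponent mu phi /\
    forall t, charfun nu t = expC (s%:C * phi t).

(* mu^s as a set function (chosen; unique by the uniqueness theorem for
   characteristic functions; 0 if it does not exist). *)
Definition mpow (mu : probability R R) (s : R) : set R -> \bar R :=
  match pselect (exists nu, is_mpow mu s nu) with
  | left h => fun A => (projT1 (cid h)) A
  | right _ => fun _ => 0%E
  end.

(* Measures on [0,oo) are represented as measures on R vanishing on
   (-oo,0); the condition rho({0}) = 0 then reads rho(]-oo,0]) = 0. *)
Definition levy_domain (rho : {measure set R -> \bar R}) : Prop :=
  rho `]-oo, (0:R)]%classic = 0%E /\
  (\int[rho]_(s in `[0%R, +oo[%classic) (Num.min 1 s)%R%:E < +oo)%E.

Definition Phi (mu : probability R R) (rho : {measure set R -> \bar R})
  (A : set R) : \bar R :=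
  (\int[rho]_(s in `[0%R, +oo[%classic) mpow mu s (A `\ 0%R))%E.

Definition symmetric_law (mu : probability R R) : Prop :=
  forall A : set R, measurable A -> mu ((fun x => - x) @` A) = mu A.

Definition is_dirac (mu : probability R R) : Prop :=
  exists a : R, forall A : set R, measurable A -> mu A = \d_a A.

End LevyDefs.

(* Main.v *)
(** For mu symmetric and infinitely divisible the characteristic function is
    exp (- psi) with psi real, continuous and nonnegative, and mu^s has
    characteristic function exp (- s psi).  Integrating 1 - cos (t x) against
    Phi_mu(rho) gives the Laplace exponent
      L(b) = \int (1 - exp (- s b)) rho(ds)   at   b = psi t.
    Since mu is not a Dirac measure, psi takes all the values of an interval
    [0, a], a > 0; L is determined by its restriction to [0, a] by analytic
    continuation, and it determines rho.

    All the uniqueness statements, as well as the measurability of the kernel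
    s |-> mu^s, come from one closure principle: a multiplicative class of
    bounded functions, closed up under linear combinations and bounded pointwise
    limits, contains the indicators {f > c} of its members, hence those of the
    sigma-algebra they generate.  The existence of mu^s for real s is obtained
    from rational s by tightness (Levy's symmetrization inequality) and an
    ultrafilter limit of distribution functions. *)

Require Import Defs.
From HB Require Import structures.
From mathcomp Require Import all_boot all_order all_algebra.
From mathcomp Require Import all_classical all_reals all_analysis.
From mathcomp Require Import measurable_realfun complex ring lra.
Import Order.TTheory GRing.Theory Num.Theory numFieldNormedType.Exports.

Set Implicit Arguments.
Unset Strict Implicit.
Unset Printing Implicit Defensive.

Local Open Scope classical_set_scope.
Local Open Scope ring_scope.

(** * Bounded closure of a class of functions *)

(** Some obstacles shape the proof. [rho] may have infinite mass near 0, so exponentials need not be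
    integrable against it; all comparisons are made under the [rho]-integrable weight 1 - exp (- s
    b), which is removed only at the end. [Phi] discards the mass of mu^s at 0, which can be
    positive, hence the test functions vanishing at 0, such as 1 - cos (t x). The n-th roots
    supplied by infinite divisibility need not be symmetric; convolving a root with its reflection
    makes it so, at the price of squaring the characteristic function, and this is why rational
    exponents take the form 2 m / n. Finally [mpow] is 0 by default where mu^s does not exist, so
    existence for every real s >= 0 must be proved before [Phi] says anything. The analytic
    continuation uses no complex variable: Taylor polynomials of exp (- d x) multiplied by exp (- k
    x) stay bounded when d <= k, so a shift of the exponent is a bounded limit, and finitely many
    shifts reach any exponent. *)

Lemma series_exp_coeff_le (R : realType) (z : R) n : `|series (exp_coeff z) n| <= expR `|z|.
Proof.
apply: le_trans (ler_norm_sum _ _ _) _.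
apply: le_trans (nondecreasing_cvgn_le _ (is_cvg_series_exp_coeff `|z|) n).
  rewrite /series/=; apply: ler_sum => i _.
  by rewrite /exp_coeff/= normrM normrX normfV normr_nat.
apply/nondecreasing_seqP => k; rewrite /series/= big_nat_recr//=.
by rewrite lerDl exp_coeff_ge0.
Qed.

Lemma cvg_expR_geo (R : realType) (d : R) : 0 < d -> expR (- (n%:R * d)) @[n --> \oo] --> 0.
Proof.
move=> d0; rewrite (_ : (fun n => _) = (fun n : nat => expR (- d) ^+ n)).
  by apply: cvg_expr; rewrite ger0_norm ?expR_ge0// expR_lt1 oppr_lt0.
by apply/funext => n; rewrite -mulrN expRM_natl.
Qed.

Section BoundedClosure.
Context {R : realType} {T : Type}.
Implicit Types (G : (T -> R) -> Prop) (f g : T -> R).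

(** In [bclos_lim] the bound is uniform in n and x, so that dominated convergence carries statements
    about integrals through this constructor. *)
Inductive bclos G : (T -> R) -> Prop :=
| bclos_gen f : G f -> bclos G f
| bclos_cst c : bclos G (fun=> c)
| bclos_lin a f g : bclos G f -> bclos G g -> bclos G (fun x => a * f x + g x)
| bclos_lim (F : nat -> T -> R) f M :
    (forall n, bclos G (F n)) -> (forall n x, `|F n x| <= M) ->
    (forall x, F n x @[n --> \oo] --> f x) -> bclos G f.

Definition bounded_gen G := forall f, G f -> exists M : R, forall x, `|f x| <= M.

(** Products only have to land in the closure: a product of two cosines is not a cosine but a
    combination of two. *)
Definition mul_gen G :=
  forall f g, G f -> G g -> bclos G (fun x => f x * g x).

Lemma bclos_ext G f g : f =1 g -> bclos G f -> bclos G g.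
Proof. by move=> /funext ->. Qed.

Lemma cvgr_norm_le (u : nat -> R) l M : (forall n, `|u n| <= M) ->
  u n @[n --> \oo] --> l -> `|l| <= M.
Proof.
by move=> uM ul; apply: (cvgr_to_le (cvg_norm ul)); exact: nearW.
Qed.

Lemma bclos_bounded G f : bounded_gen G -> bclos G f ->
  exists M : R, forall x, `|f x| <= M.
Proof.
move=> bG; elim => [{}f /bG//|c|a {}f g _ [M hM] _ [N hN]|F {}f M _ _ hM hf].
- by exists `|c|.
- exists (`|a| * M + N) => x; apply: (le_trans (ler_normD _ _)).
  by rewrite lerD// normrM ler_wpM2l.
- by exists M => x; exact: (cvgr_norm_le (hM ^~ x)).
Qed.

Lemma bclosZ G a f : bclos G f -> bclos G (fun x => a * f x).
Proof.
by move=> cf; apply: bclos_ext (bclos_lin a cf (bclos_cst G 0)) => x; rewrite addr0.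
Qed.

Lemma bclosD G f g : bclos G f -> bclos G g -> bclos G (fun x => f x + g x).
Proof.
by move=> cf cg; apply: bclos_ext (bclos_lin 1 cf cg) => x /=; rewrite mul1r.
Qed.

Lemma bclosB G f g : bclos G f -> bclos G g -> bclos G (fun x => f x - g x).
Proof.
move=> cf cg; apply: bclos_ext (bclos_lin (-1) cg cf) => x /=.
by rewrite mulN1r addrC.
Qed.

Lemma bclos_sub G G' f :
  (forall g, G g -> bclos G' g) -> bclos G f -> bclos G' f.
Proof.
move=> GG'; elim => [g /GG'//|c|a g h _ cg _ ch|F g M _ cF FM Fg].
- exact: bclos_cst.
- exact: bclos_lin.
- exact: bclos_lim FM Fg.
Qed.

(** One induction per factor: the first allows a generator on the right, the second an arbitrary
    member. Each time the bound of the fixed factor keeps the limits bounded. *)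
Lemma bclosM G f g : bounded_gen G -> mul_gen G ->
  bclos G f -> bclos G g -> bclos G (fun x => f x * g x).
Proof.
move=> bG mG.
have genM h k : bclos G h -> G k -> bclos G (fun x => h x * k x).
  move=> ch Gk; have [N hN] := bG _ Gk.
  elim: ch => [h' /mG|c|a h1 h2 _ ch1 _ ch2|F h' M _ cF hM hf].
  - exact.
  - exact/bclosZ/bclos_gen.
  - by apply: bclos_ext (bclos_lin a ch1 ch2) => x /=; rewrite mulrDl mulrA.
  - apply: (bclos_lim (M := M * N) cF) => [n x|x].
      by rewrite normrM ler_pM.
    by apply: cvgM => //; exact: cvg_cst.
move=> cf; have [M hM] := bclos_bounded bG cf.
elim => [k Gk|c|a h1 h2 _ ch1 _ ch2|F h' N _ cF hN hf].
- exact: genM.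
- by apply: bclos_ext (bclosZ c cf) => x; rewrite mulrC.
- by apply: bclos_ext (bclos_lin a ch1 ch2) => x /=; rewrite mulrDr mulrCA.
- apply: (bclos_lim (M := M * N) cF) => [n x|x].
    by rewrite normrM ler_pM.
  by apply: cvgM => //; exact: cvg_cst.
Qed.

Section Multiplicative.
Variable G : (T -> R) -> Prop.
Hypotheses (bG : bounded_gen G) (mG : mul_gen G).

Lemma bclosX f n : bclos G f -> bclos G (fun x => f x ^+ n).
Proof.
move=> cf; elim: n => [|n IHn]; first exact: bclos_cst.
by apply: bclos_ext (bclosM bG mG cf IHn) => x; rewrite exprS.
Qed.

Lemma bclos_expR f : bclos G f -> bclos G (fun x => expR (f x)).
Proof.
move=> cf; have [M hM] := bclos_bounded bG cf.
apply: (@bclos_lim G (fun n x => series (exp_coeff (f x)) n) _ (expR M)).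
- elim=> [|n IHn].
    by apply: bclos_ext (bclos_cst G 0) => x; rewrite /series/= big_geq.
  apply: bclos_ext (bclos_lin (n`!%:R^-1) (bclosX n cf) IHn) => x.
  by rewrite /series/= big_nat_recr//= addrC mulrC.
- move=> n x.
  apply: le_trans (series_exp_coeff_le _ _) _.
  by rewrite ler_expR.
- by move=> x; exact: is_cvg_series_exp_coeff.
Qed.

(* exp (- exp (- n (f - c))) tends to 1, 1/e or 0 according to the sign of
   f - c; the powers of that limit tend to the indicator. *)
Lemma bclos_gt f c : bclos G f -> bclos G (fun x => (c < f x)%R%:R).
Proof.
move=> cf.
pose u x : R := if c < f x then 1 else if c == f x then expR (-1) else 0.
have u01 x : 0 <= u x <= 1.
  rewrite /u; case: ifP => _; first by rewrite ler01 lexx.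
  by case: ifP => _; rewrite ?lexx ?ler01// expR_ge0 expR_le1 oppr_le0 ler01.
have cu : bclos G u.
  apply: (@bclos_lim G (fun n x => expR (- expR (- (n%:R * (f x - c))))) _ 1).
  - move=> n; apply: bclos_expR.
    have h : bclos G (fun x => - n%:R * (f x - c)).
      exact/bclosZ/bclosB/bclos_cst.
    apply: bclos_ext (bclosZ (-1) (bclos_expR h)) => x.
    by rewrite mulN1r mulNr.
  - by move=> n x; rewrite ger0_norm ?expR_ge0// expR_le1 oppr_le0 expR_ge0.
  - move=> x; rewrite /u; have [cx|xc|cx] := ltgtP c (f x).
    + rewrite -[X in _ --> X](@expR0 R) -oppr0.
      apply: continuous_cvg; first exact: continuous_expR.
      by apply: cvgN; apply: cvg_expR_geo; rewrite subr_gt0.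
    + have d0 : 0 < c - f x by rewrite subr_gt0.
      (* With y = n (c - f x): exp (- exp y) <= exp (- y), because exp y >= 1 + y >= y. *)
      apply: squeeze_cvgr (cvg_cst 0) (cvg_expR_geo d0).
      apply: nearW => n; rewrite expR_ge0/= ler_expR lerN2.
      rewrite -mulrN opprB; apply: le_trans (expR_ge1Dx _).
      by rewrite lerDr.
    + rewrite cx (_ : (fun n : nat => _) = cst (expR (-1))); first exact: cvg_cst.
      by apply/funext => n; rewrite subrr mulr0 oppr0 expR0.
apply: (@bclos_lim G (fun n x => u x ^+ n) _ 1).
- by move=> n; exact: bclosX.
- move=> n x; have /andP[u0 u1] := u01 x.
  by rewrite normrX ger0_norm// exprn_ile1.
- move=> x; have /andP[u0 u1] := u01 x.
  have [cx|xc] := ltP c (f x).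
    rewrite /u cx (_ : (fun n => _) = cst 1); first exact: cvg_cst.
    by apply/funext => n; rewrite expr1n.
  apply: cvg_expr; rewrite ger0_norm// /u (ltNge c) xc/=.
  by case: ifP; rewrite ?ltr01// expR_lt1 oppr_lt0 ltr01.
Qed.

End Multiplicative.
End BoundedClosure.

(** * Borel indicators from trigonometric and exponential functions *)

Section BorelIndicators.
Context {R : realType}.
Implicit Types G : (R -> R) -> Prop.

(** Sets are cut by [D] because the exponential generators are constant on the negative half-line
    and separate points only on the positive one. *)
Lemma bclos_sigma_algebra G (D : set R) : bounded_gen G -> mul_gen G ->
  bclos G \1_D ->
  sigma_algebra [set: R] [set A | bclos G (\1_(D `&` A) : R -> R)].
Proof.
move=> bG mG cD; split => /=.
- by rewrite setI0 indic0; exact: bclos_cst.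
- move=> A cA; apply: bclos_ext (bclosB cD cA) => x.
  rewrite setTD !indicE !in_setI in_setC.
  by case: (x \in D); case: (x \in A); rewrite /= ?subrr ?subr0.
- move=> A cA.
  pose B n := \bigcup_(k < n) A k.
  apply: (@bclos_lim _ _ G (fun n => \1_(D `&` B n)) _ 1).
  + elim=> [|n IHn].
      by rewrite /B bigcup_mkord big_ord0 setI0 indic0; exact: bclos_cst.
    (* The indicator of a union is f + g - f g. *)
    apply: bclos_ext (bclosB (bclosD IHn (cA n)) (bclosM bG mG IHn (cA n))) => x.
    have -> : B n.+1 = B n `|` A n by rewrite /B !bigcup_mkord big_ord_recr.
    rewrite !indicE !in_setI in_setU.
    by case: (x \in D); case: (x \in A n); case: (x \in B n); rewrite /=; ring.
  + by move=> n x; rewrite indicE; case: (_ \in _); rewrite ?normr1 ?normr0.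
  + move=> x; apply: cvg_near_cst.
    have [[k _ Akx]|nA] := pselect ((\bigcup_k A k) x).
      exists k.+1 => // n /= kn; rewrite !indicE !in_setI.
      by congr (_ && _)%:R; apply/idP/idP => _; rewrite inE; exists k.
    apply: nearW => n; rewrite !indicE !in_setI.
    congr (_ && _)%:R; apply/idP/idP; rewrite !inE //.
    by move=> [k _ Akx]; exists k.
Qed.

Lemma bclos_borel G (D : set R) : bounded_gen G -> mul_gen G ->
  bclos G \1_D -> (forall a, bclos G \1_(D `&` `]a, +oo[)) ->
  forall A, measurable A -> bclos G \1_(D `&` A).
Proof.
move=> bG mG cD ca A.
have -> : measurable A = <<s (@RGenOInfty.G R) >> A.
  exact: (congr1 (@^~ A) (RGenOInfty.measurableE R)).
move: A.
apply: smallest_sub; first exact: bclos_sigma_algebra.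
by move=> _ [a ->]; exact: ca.
Qed.

Definition trig_gen (f : R -> R) :=
  exists t, f = (fun x => cos (t * x)) \/ f = (fun x => sin (t * x)).

Lemma trig_gen_bounded : bounded_gen trig_gen.
Proof. by move=> f [t [->|->]]; exists 1 => x; rewrite ?cos_max ?sin_max. Qed.

Lemma bclos_cos t : bclos trig_gen (fun x => cos (t * x)).
Proof. by apply: bclos_gen; exists t; left. Qed.

Lemma bclos_sin t : bclos trig_gen (fun x => sin (t * x)).
Proof. by apply: bclos_gen; exists t; right. Qed.

Lemma trig_gen_mul : mul_gen trig_gen.
Proof.
move=> f g [s [->|->]] [t [->|->]].
- apply: bclos_ext (bclosZ 2^-1 (bclosD (bclos_cos (s + t)) (bclos_cos (s - t)))) => x.
  by rewrite !mulrDl mulNr cosB cosD; field.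
- apply: bclos_ext (bclosZ 2^-1 (bclosB (bclos_sin (s + t)) (bclos_sin (s - t)))) => x.
  by rewrite !mulrDl mulNr sinB sinD; field.
- apply: bclos_ext (bclosZ 2^-1 (bclosD (bclos_sin (s + t)) (bclos_sin (s - t)))) => x.
  by rewrite !mulrDl mulNr sinB sinD; field.
- apply: bclos_ext (bclosZ 2^-1 (bclosB (bclos_cos (s - t)) (bclos_cos (s + t)))) => x.
  by rewrite !mulrDl mulNr cosB cosD; field.
Qed.

(* The half-line ]a, +oo[ is the limit of the periodic sets
   sin ((x - a) / n) > 0. *)
Lemma bclos_trig_borel (A : set R) : measurable A -> bclos trig_gen \1_A.
Proof.
move=> mA; rewrite -(setTI A).
apply: bclos_borel mA; [exact: trig_gen_bounded|exact: trig_gen_mul| |].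
  by rewrite indicT; exact: bclos_cst.
move=> a; rewrite setTI.
have cf n : bclos trig_gen (fun x => sin (n.+1%:R^-1 * (x - a))).
  have h := bclos_lin (cos (n.+1%:R^-1 * a)) (bclos_sin n.+1%:R^-1)
    (bclosZ (- sin (n.+1%:R^-1 * a)) (bclos_cos n.+1%:R^-1)).
  by apply: bclos_ext h => x /=; rewrite mulrBr sinB; ring.
apply: (@bclos_lim _ _ _ (fun n x => (0 < sin (n.+1%:R^-1 * (x - a)))%R%:R) _ 1).
- by move=> n; exact: (bclos_gt trig_gen_bounded trig_gen_mul 0 (cf n)).
- by move=> n x; case: (0 < _); rewrite ?normr1 ?normr0.
move=> x; apply: cvg_near_cst; near=> n.
rewrite indicE; congr (nat_of_bool _)%:R.
(* On (-2, 2) the sine has the sign of its argument. *)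
have small : `|n.+1%:R^-1 * (x - a)| < 2.
  rewrite normrM ger0_norm ?invr_ge0// mulrC ltr_pdivrMr//.
  have : `|x - a| < n%:R by near: n; exact: nbhs_infty_gtr.
  by rewrite -natr1; have := normr_ge0 (x - a); lra.
have n0 : (0 : R) < n.+1%:R^-1 by rewrite invr_gt0.
apply/idP/idP; last first.
  rewrite inE/= in_itv/= andbT => ax; apply: sin2_gt0.
  rewrite mulr_gt0 ?subr_gt0//=.
  exact: le_lt_trans (ler_norm _) small.
apply: contraLR; rewrite notin_setE/= in_itv/= andbT => /negP; rewrite -!leNgt.
move=> xa; rewrite -oppr_ge0 -sinN -mulrN opprB.
move: xa; rewrite le_eqVlt => /predU1P[->|xa]; first by rewrite subrr mulr0 sin0.
apply/ltW/sin2_gt0; rewrite mulr_gt0 ?subr_gt0//=.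
by rewrite -(opprB x) mulrN; apply: le_lt_trans small; rewrite -normrN ler_norm.
Unshelve. all: end_near. Qed.

(** Truncating at 0 makes the exponential bounded on the whole line and leaves it unchanged on the
    half-line that carries [rho]. *)
Definition exp_gen (f : R -> R) :=
  exists2 k, 0 <= k & f = (fun x => expR (- (k * Num.max x 0))).

Lemma exp_gen_bounded : bounded_gen exp_gen.
Proof.
move=> f [k k0 ->]; exists 1 => x; rewrite ger0_norm ?expR_ge0//.
by rewrite expR_le1 oppr_le0 mulr_ge0// le_max lexx orbT.
Qed.

Lemma exp_gen_mul : mul_gen exp_gen.
Proof.
move=> f g [k k0 ->] [l l0 ->]; apply: bclos_gen; exists (k + l).
  by rewrite addr_ge0.
by apply/funext => x; rewrite -expRD mulrDl opprD.
Qed.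

Lemma bclos_exp_borel (A : set R) : measurable A ->
  bclos exp_gen \1_(`]0, +oo[ `&` A).
Proof.
have h a : 0 <= a -> bclos exp_gen \1_(`]a, +oo[).
  move=> a0.
  (* Since a >= 0, - exp (- max x 0) exceeds - exp (- a) exactly when x > a. *)
  have ce : bclos exp_gen (fun x => -1 * expR (- (1 * Num.max x 0))).
    by apply/bclosZ/bclos_gen; exists 1.
  apply: bclos_ext (bclos_gt exp_gen_bounded exp_gen_mul (- expR (- a)) ce) => x.
  rewrite indicE mulN1r ltrN2 ltr_expR ltrN2 mul1r; congr (nat_of_bool _)%:R.
  rewrite lt_max [a < 0]ltNge a0 orbF.
  by apply/idP/idP; rewrite inE/= in_itv/= andbT.
apply: bclos_borel; [exact: exp_gen_bounded|exact: exp_gen_mul|exact: h|].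
move=> a; have -> : `]0, +oo[ `&` `]a, +oo[ = `](Num.max 0 a), +oo[%classic :> set R.
  apply/seteqP; split => x /=; rewrite !in_itv/= !andbT gt_max.
    by move=> [-> ->].
  by move=> /andP[].
by apply: h; rewrite le_max lexx.
Qed.

End BorelIndicators.

(** * Measures determined by a class of functions *)

Section IntegralsOfBoundedClosure.
Context {R : realType}.
Implicit Types (G : (R -> R) -> Prop) (m : {measure set R -> \bar R}).

Definition measurable_gen G := forall f, G f -> measurable_fun [set: R] f.

Lemma bclos_measurable G f : measurable_gen G -> bclos G f ->
  measurable_fun [set: R] f.
Proof.
move=> mG; elim => [{}f /mG//|c|a {}f g _ mf _ mg|F {}f M _ mF _ Ff].
- exact: measurable_cst.
- by apply: measurable_funD => //; apply: measurable_funM => //; exact: measurable_cst.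
- exact: (measurable_fun_cvg mF (fun x _ => Ff x)).
Qed.

Lemma bounded_weight_integrable m (D : set R) (w f : R -> R) M :
  measurable D -> m.-integrable D (EFin \o w) ->
  measurable_fun [set: R] f -> (forall x, `|f x| <= M) ->
  m.-integrable D (EFin \o (fun x => f x * w x)).
Proof.
move=> mD iw mf fM.
have mw : measurable_fun D w by apply/measurable_EFinP; exact: measurable_int iw.
apply: (@le_integrable _ _ _ m D mD _ (fun x => M%:E * (EFin \o w) x)%E).
- apply/measurable_EFinP; apply: measurable_funM => //.
  exact: measurable_funS mf.
- move=> x Dx /=; rewrite !normrM lee_fin ler_wpM2r//.
  exact: le_trans (fM x) (ler_norm _).
- exact: integrableZl.
Qed.

Lemma cvg_Rintegral_weight m (D : set R) (w : R -> R) (F : nat -> R -> R) (f : R -> R) (M : R) :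
  measurable D -> m.-integrable D (EFin \o w) ->
  (forall n, measurable_fun [set: R] (F n)) ->
  (forall n x, `|F n x| <= M) -> (forall x, F n x @[n --> \oo] --> f x) ->
  \int[m]_(x in D) (F n x * w x) @[n --> \oo] --> \int[m]_(x in D) (f x * w x).
Proof.
move=> mD iw mF FM Ff.
have mf : measurable_fun [set: R] f by exact: (measurable_fun_cvg mF (fun x _ => Ff x)).
have fM x : `|f x| <= M by exact: (cvgr_norm_le (FM ^~ x)).
have If := bounded_weight_integrable mD iw mf fM.
apply: fine_cvg; rewrite fineK; last exact: integrable_fin_num.
apply: (@dominated_cvg _ _ _ m D mD (fun n x => (F n x * w x)%:E) _
  (fun x => M%:E * `|(w x)%:E|)%E).
- by move=> n; exact: measurable_int (bounded_weight_integrable mD iw (mF n) (FM n)).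
- move=> x _; apply: cvg_EFin; first exact: nearW.
  by apply: cvgM; [exact: Ff|exact: cvg_cst].
- by [].
- by apply: integrableZl => //; exact: integrable_abse.
- by move=> n x _ /=; rewrite normrM lee_fin ler_wpM2r.
Qed.

(** The weight [w] makes bounded functions integrable against measures that may be infinite.
    Equality of the integrals of [w] itself takes care of the constants. For probabilities the
    weight is 1. *)
Lemma bclos_Rintegral_eq G m m' (D : set R) (w : R -> R) f :
  bounded_gen G -> measurable_gen G -> measurable D ->
  m.-integrable D (EFin \o w) -> m'.-integrable D (EFin \o w) ->
  \int[m]_(x in D) w x = \int[m']_(x in D) w x ->
  (forall g, G g ->
    \int[m]_(x in D) (g x * w x) = \int[m']_(x in D) (g x * w x)) ->
  bclos G f -> \int[m]_(x in D) (f x * w x) = \int[m']_(x in D) (f x * w x).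
Proof.
move=> bG mG mD iw iw' ew eG.
elim => [//|c|a {}f g cf ef cg eg|F {}f M cF eF FM Ff].
- by rewrite !RintegralZl// ew.
- have [Mf fM] := bclos_bounded bG cf; have [Mg gM] := bclos_bounded bG cg.
  have mf := bclos_measurable mG cf; have mg := bclos_measurable mG cg.
  have expand (n : {measure set R -> \bar R}) : n.-integrable D (EFin \o w) ->
     \int[n]_(x in D) ((a * f x + g x) * w x) =
     a * \int[n]_(x in D) (f x * w x) + \int[n]_(x in D) (g x * w x).
    move=> inw.
    have jf := bounded_weight_integrable mD inw mf fM.
    have jg := bounded_weight_integrable mD inw mg gM.
    rewrite -RintegralZl// -RintegralD//; last exact: (integrableZl mD a jf).
    by apply: eq_Rintegral => x _; rewrite mulrDl mulrA.
  by rewrite !expand// ef eg.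
- have mF n := bclos_measurable mG (cF n).
  have := cvg_Rintegral_weight mD iw mF FM Ff.
  rewrite (_ : (fun n => _) = (fun n => \int[m']_(x in D) (F n x * w x))).
    by move/cvg_unique; apply => //; exact: cvg_Rintegral_weight.
  by apply/funext => n; exact: eF.
Qed.

End IntegralsOfBoundedClosure.

Section Probabilities.
Context {R : realType}.
Implicit Types (G : (R -> R) -> Prop) (P Q : probability R R).

Lemma integrable_one P : P.-integrable [set: R] (EFin \o cst 1).
Proof. exact: finite_measure_integrable_cst. Qed.

Lemma probability_bounded_integrable d (T : measurableType d)
    (P : probability T R) (f : T -> R) (M : R) :
  measurable_fun [set: T] f -> (forall x, `|f x| <= M) ->
  P.-integrable [set: T] (EFin \o f).
Proof.
move=> mf fM.
apply: (le_integrable _ _ _ (finite_measure_integrable_cst P M measurableT)) => //.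
  exact/measurable_EFinP.
by move=> x _ /=; rewrite lee_fin; apply: le_trans (fM x) (ler_norm _).
Qed.

Lemma cvg_Rintegral_bounded P (F : nat -> R -> R) (f : R -> R) (M : R) :
  (forall n, measurable_fun [set: R] (F n)) ->
  (forall n x, `|F n x| <= M) -> (forall x, F n x @[n --> \oo] --> f x) ->
  \int[P]_x F n x @[n --> \oo] --> \int[P]_x f x.
Proof.
move=> mF FM Ff.
have := cvg_Rintegral_weight measurableT (integrable_one P) mF FM Ff.
have E g : \int[P]_x (g x * cst 1 x) = \int[P]_x g x.
  by apply: eq_Rintegral => x _ /=; rewrite mulr1.
by rewrite E (_ : (fun n => _) = (fun n => \int[P]_x F n x))//; apply/funext.
Qed.

Lemma Rintegral_probability_cst P c : \int[P]_x c = c.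
Proof.
rewrite Rintegral_cst// -[RHS]mulr1; congr (_ * _).
exact: (congr1 fine (probability_setT P)).
Qed.

Lemma Rintegral_indic P (A : set R) : measurable A ->
  \int[P]_x \1_A x = fine (P A).
Proof. by move=> mA; rewrite /Rintegral integral_indic// setIT. Qed.

Lemma trig_gen_measurable : measurable_gen (@trig_gen R).
Proof.
move=> f [t [->|->]]; apply: continuous_measurable_fun => x.
- apply: continuous_comp; [exact: mulrl_continuous|exact: continuous_cos].
- apply: continuous_comp; [exact: mulrl_continuous|exact: continuous_sin].
Qed.

Lemma trig_integrable P f : trig_gen f -> P.-integrable [set: R] (EFin \o f).
Proof.
move=> gf; have [M fM] := trig_gen_bounded gf.
exact: probability_bounded_integrable (trig_gen_measurable gf) fM.
Qed.

Lemma probability_eq_trig P Q :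
  (forall t, \int[P]_x cos (t * x) = \int[Q]_x cos (t * x)) ->
  (forall t, \int[P]_x sin (t * x) = \int[Q]_x sin (t * x)) ->
  forall A, measurable A -> P A = Q A.
Proof.
move=> ec es A mA.
have E N g : \int[N]_x (g x * cst 1 x) = \int[N]_x g x.
  by apply: eq_Rintegral => x _ /=; rewrite mulr1.
have : \int[P]_x (\1_A x * cst 1 x) = \int[Q]_x (\1_A x * cst 1 x).
  apply: (bclos_Rintegral_eq (G := trig_gen)) => //.
  - exact: trig_gen_bounded.
  - exact: trig_gen_measurable.
  - exact: integrable_one.
  - exact: integrable_one.
  - by rewrite !Rintegral_probability_cst.
  - by move=> g [t [->|->]]; rewrite !E.
  - exact: bclos_trig_borel.
rewrite !E !Rintegral_indic// => PQ.
by rewrite -[LHS]fineK ?fin_num_measure// PQ fineK ?fin_num_measure.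
Qed.

(** Measurability in s of the integral of f survives linear combinations and, by dominated
    convergence, bounded limits; so the trigonometric integrals decide for all Borel sets. *)
Lemma measurable_kernel_trig (nu : R -> probability R R) (E : set R) :
  measurable E ->
  (forall t, measurable_fun E (fun s => \int[nu s]_x cos (t * x))) ->
  (forall t, measurable_fun E (fun s => \int[nu s]_x sin (t * x))) ->
  forall A, measurable A -> measurable_fun E (fun s => nu s A).
Proof.
move=> mE mc ms A mA.
suff h f : bclos trig_gen f -> measurable_fun E (fun s => \int[nu s]_x f x).
  have hm : measurable_fun E (EFin \o (fun s => \int[nu s]_x \1_A x)).
    by apply/measurable_EFinP; exact: h (bclos_trig_borel mA).
  by apply: eq_measurable_fun hm => s _ /=; rewrite Rintegral_indic// fineK// fin_num_measure.
elim => [g [t [->|->]]//|c|a {}f g cf hf cg hg|F {}f M cF hF FM Ff].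
- rewrite (_ : (fun s => _) = cst c); first exact: measurable_cst.
  by apply/funext => s; exact: Rintegral_probability_cst.
- have [Mf fM] := bclos_bounded trig_gen_bounded cf.
  have [Mg gM] := bclos_bounded trig_gen_bounded cg.
  have mf := bclos_measurable trig_gen_measurable cf.
  have mg := bclos_measurable trig_gen_measurable cg.
  rewrite (_ : (fun s => _) = (fun s => a * \int[nu s]_x f x + \int[nu s]_x g x)).
    by apply: measurable_funD => //; apply: measurable_funM => //; exact: measurable_cst.
  apply/funext => s.
  have jf := probability_bounded_integrable (nu s) mf fM.
  have jg := probability_bounded_integrable (nu s) mg gM.
  by rewrite -RintegralZl// -RintegralD//; exact: (integrableZl measurableT a jf).
- have mF n := bclos_measurable trig_gen_measurable (cF n).
  apply: (measurable_fun_cvg hF) => s _.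
  exact: cvg_Rintegral_bounded.
Qed.

End Probabilities.

(** * Uniqueness of Laplace exponents *)

Section Laplace.
Context {R : realType}.
Implicit Types (G : (R -> R) -> Prop) (rho : {measure set R -> \bar R}).

Definition expmax (k x : R) : R := expR (- (k * Num.max x 0)).

Lemma max0_ge0 (x : R) : 0 <= Num.max x 0.
Proof. by rewrite le_max lexx orbT. Qed.

Lemma expmaxD k l x : expmax (k + l) x = expmax k x * expmax l x.
Proof. by rewrite /expmax mulrDl opprD expRD. Qed.

(** Multiplied by [expmax k x], this is minus the difference quotient of l |-> [expmax l x] at k
    with step h; as h tends to 0 it brings down a factor max x 0. *)
Definition expquot (h x : R) : R := (1 - expmax h x) / h.

Lemma expquot_ge0 h x : 0 < h -> 0 <= expquot h x.
Proof.
move=> h0; rewrite divr_ge0 ?(ltW h0)// subr_ge0 expR_le1 oppr_le0.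
by rewrite mulr_ge0 ?(ltW h0)// max0_ge0.
Qed.

Lemma expquot_le h x : 0 < h -> expquot h x <= Num.max x 0.
Proof.
move=> h0; rewrite ler_pdivrMr// mulrC.
by have := expR_ge1Dx (- (h * Num.max x 0)); rewrite /expmax; lra.
Qed.

Lemma expquot_ge h x : 0 < h -> Num.max x 0 * expmax h x <= expquot h x.
Proof.
move=> h0; rewrite ler_pdivlMr// /expmax; set y := Num.max x 0.
(* The claim amounts to (1 + h y) exp (- h y) <= 1. *)
have := expR_ge1Dx (h * y); have := expRxMexpNx_1 (h * y).
have := expR_gt0 (- (h * y)).
move: (expR _) (expR _) => u v v0 uv huv.
have := ler_wpM2r (ltW v0) huv; nra.
Qed.

Lemma cvg_expquot (h : nat -> R) x : (forall n, 0 < h n) ->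
  h n @[n --> \oo] --> 0 ->
  expquot (h n) x @[n --> \oo] --> Num.max x 0.
Proof.
move=> h0 hl; apply: (@squeeze_cvgr _ _ _ _ (fun n => Num.max x 0 * expmax (h n) x)
  (fun=> Num.max x 0)).
- by apply: nearW => n; rewrite expquot_ge// expquot_le.
- rewrite -[X in _ --> X]mulr1; apply: cvgM; first exact: cvg_cst.
  rewrite -(@expR0 R) -oppr0 -(mul0r (Num.max x 0)).
  apply: continuous_cvg; first exact: continuous_expR.
  by apply: cvgN; apply: cvgM => //; exact: cvg_cst.
- exact: cvg_cst.
Qed.

(** The n-th iterated difference at k uses only the exponents k, k + h, ..., k + n h, whence the
    condition that the last one be at most b. *)
Lemma bclos_expquotX G (b h : R) n (k : R) : 0 < h -> 0 <= k -> k + n%:R * h <= b ->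
  (forall l, 0 <= l <= b -> bclos G (expmax l)) ->
  bclos G (fun x => expmax k x * expquot h x ^+ n).
Proof.
move=> h0 + + cG; elim: n k => [|n IHn] k k0.
  rewrite mul0r addr0 => kb.
  by apply: bclos_ext (cG _ _) => [x|]; rewrite ?expr0 ?mulr1// k0.
rewrite -natr1 mulrDl mul1r => kb.
have c1 : bclos G (fun x => expmax k x * expquot h x ^+ n).
  by apply: IHn => //; apply: le_trans kb; rewrite addrA lerDl ltW.
have c2 : bclos G (fun x => expmax (k + h) x * expquot h x ^+ n).
  by apply: IHn; [rewrite addr_ge0// ltW|rewrite -addrA (addrC h)].
apply: bclos_ext (bclosZ h^-1 (bclosB c1 c2)) => x.
by rewrite expmaxD exprS /expquot; ring.
Qed.

(* Taylor expansion of exp (- d x) at the exponent k: its coefficients are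
   derivatives of l |-> exp (- l x) at k, i.e. limits of difference quotients. *)
Lemma bclos_expmax_shift G (b k d : R) : 0 <= d <= k -> k < b ->
  (forall l, 0 <= l <= b -> bclos G (expmax l)) -> bclos G (expmax (k + d)).
Proof.
move=> /andP[d0 dk] kb cG; have k0 := le_trans d0 dk.
(* Here d <= k matters: the partial sum is at most exp (d y), which exp (- k max z 0) absorbs. *)
have bnd (y z : R) n : 0 <= y <= Num.max z 0 ->
    `|expmax k z * series (exp_coeff (- d * y)) n| <= 1.
  move=> /andP[y0 yz]; rewrite normrM ger0_norm ?expR_ge0//.
  apply: le_trans (ler_wpM2l (expR_ge0 _) (series_exp_coeff_le _ n)) _.
  rewrite -expRD expR_le1 normrM normrN !ger0_norm// addrC subr_le0.
  exact: ler_pM.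
have cont n : continuous (fun z : R => series (exp_coeff (- d * z)) n).
  elim: n => [|n IHn] z.
    rewrite (_ : (fun z => _) = cst 0); first exact: cvg_cst.
    by apply/funext => y; rewrite /series/= big_geq.
  rewrite (_ : (fun z => _) = (fun z => series (exp_coeff (- d * z)) n +
      (- d * z) ^+ n / n`!%:R)); last first.
    by apply/funext => y; rewrite /series/= big_nat_recr.
  apply: cvgD; first exact: IHn.
  apply: cvgM; last exact: cvg_cst.
  apply: (@continuous_comp _ _ _ ( *%R (- d)) (fun z => z ^+ n)).
    exact: mulrl_continuous.
  exact: exprn_continuous.
apply: (@bclos_lim _ _ _
  (fun n x => expmax k x * series (exp_coeff (- d * Num.max x 0)) n) _ 1).
- move=> n.
  (* The step tends to 0 with m, and n steps from k never leave [0, b]. *)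
  pose h m : R := (b - k) / n.+1%:R / m.+1%:R.
  have h0 m : 0 < h m by rewrite !divr_gt0// subr_gt0.
  have hb m i : (i <= n)%N -> k + i%:R * h m <= b.
    move=> im; rewrite -lerBrDl.
    rewrite (_ : i%:R * h m = (b - k) * (i%:R / (n.+1 * m.+1)%:R)); last first.
      by rewrite /h natrM invfM; ring.
    rewrite ler_piMr ?subr_ge0 ?(ltW kb)// ler_pdivrMr// mul1r ler_nat.
    exact: leq_trans (leqW im) (leq_pmulr _ _).
  apply: (@bclos_lim _ _ _
    (fun m x => expmax k x * series (exp_coeff (- d * expquot (h m) x)) n) _ 1).
  + move=> m.
    have : (n <= n)%N by [].
    (* [h] keeps the original n while the degree i of the partial sum grows below it. *)
    elim: {-2}n => [_|i IHi im].
      by apply: bclos_ext (bclos_cst G 0) => x; rewrite /series/= big_geq// mulr0.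
    have c := bclos_expquotX (h0 m) k0 (hb m i (ltnW im)) cG.
    apply: bclos_ext (bclos_lin ((- d) ^+ i / i`!%:R) c (IHi (ltnW im))) => x.
    by rewrite /series/= big_nat_recr//= /exp_coeff/= (exprMn _ (- d)); ring.
  + by move=> m x; apply: bnd; rewrite expquot_ge0// expquot_le.
  + move=> x; apply: cvgM; first exact: cvg_cst.
    have hl : h m @[m --> \oo] --> 0.
      rewrite -(mulr0 ((b - k) / n.+1%:R)); apply: cvgM; first exact: cvg_cst.
      exact: cvg_harmonic.
    pose S (z : R) : R := series (exp_coeff (- d * z)) n.
    suff : (S \o (fun m => expquot (h m) x)) @ \oo --> S (Num.max x 0) by [].
    apply: continuous_cvg; first exact: cont.
    exact: cvg_expquot.
- by move=> n x; apply: bnd; rewrite max0_ge0/=.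
- move=> x; rewrite expmaxD; apply: cvgM; first exact: cvg_cst.
  by rewrite /expmax -mulNr; exact: is_cvg_series_exp_coeff.
Qed.

Definition exp_gen_upto (b : R) (f : R -> R) :=
  exists2 k, 0 <= k <= b & f = expmax k.

(** This replaces analytic continuation: each round of shifts enlarges the reachable range of
    exponents by b / 2. *)
Lemma bclos_exp_gen_upto b f : 0 < b ->
  bclos exp_gen f -> bclos (exp_gen_upto b) f.
Proof.
move=> b0; apply: bclos_sub => {f} _ [k k0 ->].
have h n l : 0 <= l <= b * (1 + n%:R / 2) -> bclos (exp_gen_upto b) (expmax l).
  elim: n l => [|n IHn] l /andP[l0 lb].
    by apply: bclos_gen; exists l => //; rewrite l0/=; lra.
  have bn : b <= b * (1 + n%:R / 2).
    by rewrite ler_peMr ?(ltW b0)// lerDl divr_ge0.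
  have [lbn|bnl] := leP l (b * (1 + n%:R / 2)); first by apply: IHn; rewrite l0.
  (* The shift 2/5 l does not exceed the base 3/5 l, and the base lies strictly inside the range
     already reached, because 3/5 (3 + n) < 2 + n. *)
  rewrite (_ : l = 3 / 5 * l + 2 / 5 * l); last by field.
  rewrite -natr1 in lb.
  apply: (bclos_expmax_shift _ _ IHn); last by nra.
  by apply/andP; split; lra.
have [n kn] : exists n : nat, k <= b * (1 + n%:R / 2).
  exists (Num.truncn (2 * k / b)).+1.
  have : 2 * k / b < (Num.truncn (2 * k / b)).+1%:R.
    exact: truncnS_gt.
  rewrite ltr_pdivrMr// => ?; nra.
by apply: (h n); rewrite k0.
Qed.

End Laplace.

Lemma cvg_nondecreasing_integral d (T : measurableType d) (R : realType)
    (m : {measure set T -> \bar R}) (D : set T) (g : nat -> T -> \bar R) f :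
  measurable D -> (forall n, measurable_fun D (g n)) ->
  (forall n x, D x -> 0 <= g n x)%E ->
  (forall x, D x -> {homo g^~ x : n k / (n <= k)%N >-> (n <= k)%E}) ->
  (forall x, D x -> g n x @[n --> \oo] --> f x) ->
  (\int[m]_(x in D) g n x @[n --> \oo] --> \int[m]_(x in D) f x)%E.
Proof.
move=> mD mg g0 ndg gf.
have -> : (\int[m]_(x in D) f x = \int[m]_(x in D) limn (g ^~ x))%E.
  by apply: eq_integral => x; rewrite inE => Dx; apply/esym/cvg_lim => //; exact: gf.
exact: cvg_monotone_convergence.
Qed.

Section LaplaceUniqueness.
Context {R : realType}.
Implicit Types rho : {measure set R -> \bar R}.
Local Notation D := (`[0%R, +oo[%classic : set R).

Lemma itvcy_measurable : measurable D. Proof. exact: measurable_itv. Qed.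
Local Hint Resolve itvcy_measurable : core.

Lemma measurable_onem_exp (b : R) : measurable_fun [set: R] (fun s => 1 - expR (- (s * b))).
Proof.
apply: measurable_funB => //; apply: measurableT_comp => //.
by apply: measurableT_comp => //; apply: measurable_funM.
Qed.

Lemma levy_domain_integrable rho (b : R) : levy_domain rho -> 0 <= b ->
  rho.-integrable D (EFin \o (fun s => 1 - expR (- (s * b)))).
Proof.
move=> [_ fin] b0.
have im : rho.-integrable D (EFin \o (fun s => Num.min 1 s)).
  apply/integrableP; split.
    by apply/measurable_EFinP; apply: measurable_funTS; exact: measurable_minr.
  apply: le_lt_trans fin; rewrite le_eqVlt; apply/orP; left; apply/eqP.
  apply: eq_integral => s; rewrite inE/= in_itv/= andbT => s0.
  by rewrite ger0_norm// le_min ler01.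
(* 1 - exp (- s b) is at most 1 and at most s b, hence at most (1 + b) min (1, s). *)
have im' := integrableZl itvcy_measurable (1 + b) im.
apply: (le_integrable _ _ _ im') => //.
- by apply/measurable_EFinP; apply: measurable_funTS; exact: measurable_onem_exp.
- move=> s /=; rewrite in_itv/= andbT => s0.
  have e1 : expR (- (s * b)) <= 1 by rewrite expR_le1 oppr_le0 mulr_ge0.
  have e0 := expR_ge0 (- (s * b)).
  have e2 := expR_ge1Dx (- (s * b)).
  rewrite lee_fin !ger0_norm ?subr_ge0// ?mulr_ge0 ?addr_ge0// ?le_min ?ler01//.
  by rewrite /Num.min; case: ifPn; nra.
Qed.

Lemma laplace_exponent_inj rho rho' (a : R) : levy_domain rho ->
  levy_domain rho' -> 0 < a ->
  (forall b, 0 <= b <= a -> \int[rho]_(s in D) (1 - expR (- (s * b))) =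
    \int[rho']_(s in D) (1 - expR (- (s * b)))) ->
  forall A, measurable A -> rho A = rho' A.
Proof.
move=> lr lr' a0 eL A mA.
(* Multiplying the weight by exp (- k s) gives a difference of Laplace integrands at k + b and k;
   for k <= b both exponents must stay below a. *)
pose b := a / 2; have b0 : 0 < b by rewrite divr_gt0.
pose w (s : R) := 1 - expR (- (s * b)).
have iw : rho.-integrable D (EFin \o w) by apply: levy_domain_integrable => //; exact: ltW.
have iw' : rho'.-integrable D (EFin \o w) by apply: levy_domain_integrable => //; exact: ltW.
have w0 s : 0 <= s -> 0 <= w s.
  by move=> s0; rewrite subr_ge0 expR_le1 oppr_le0 mulr_ge0// ltW.
have bG : bounded_gen (exp_gen_upto b).
  move=> f [k /andP[k0 _] ->]; exists 1 => x; rewrite ger0_norm ?expR_ge0//.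
  by rewrite expR_le1 oppr_le0 mulr_ge0// max0_ge0.
have mG : measurable_gen (exp_gen_upto b).
  move=> f [k _ ->]; rewrite /expmax; apply: measurableT_comp => //.
  apply: measurableT_comp => //; apply: measurable_funM => //.
  exact: measurable_maxr.
have eG g : exp_gen_upto b g ->
    \int[rho]_(x in D) (g x * w x) = \int[rho']_(x in D) (g x * w x).
  move=> [k /andP[k0 kb] ->].
  have expand (m : {measure set R -> \bar R}) : levy_domain m ->
      \int[m]_(x in D) (expmax k x * w x) =
      \int[m]_(s in D) (1 - expR (- (s * (k + b)))) -
      \int[m]_(s in D) (1 - expR (- (s * k))).
    move=> lm; rewrite -RintegralB//.
    - apply: eq_Rintegral => x; rewrite inE/= in_itv/= andbT => x0.
      rewrite /expmax /w max_l// mulrBr mulr1 -expRD mulrDr opprD (mulrC k).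
      by ring.
    - by apply: levy_domain_integrable => //; rewrite addr_ge0// ltW.
    - exact: levy_domain_integrable.
  rewrite !expand// !eL//.
    by rewrite k0/=; rewrite /b in kb; lra.
  by apply/andP; rewrite /b in kb b0 *; split; lra.
have ew : \int[rho]_(x in D) w x = \int[rho']_(x in D) w x.
  by apply: eL; rewrite ltW//= /b; lra.
have eh h : bclos exp_gen h ->
    \int[rho]_(x in D) (h x * w x) = \int[rho']_(x in D) (h x * w x).
  move=> ch; apply: (bclos_Rintegral_eq bG mG) => //.
  exact: bclos_exp_gen_upto.
pose I : set R := `]0, +oo[%classic.
have mI : measurable I by exact: measurable_itv.
have mIA : measurable (I `&` A) by exact: measurableI.
(* The geometric sum divides the weight out: times [w] it equals 1 - exp (- N b s), which increases
   to 1 for s > 0. *)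
pose h N (x : R) : R := \1_(I `&` A) x * \sum_(j < N) expmax (j%:R * b) x.
have ch N : bclos exp_gen (h N).
  apply: bclosM; [exact: exp_gen_bounded|exact: exp_gen_mul| |].
    exact: bclos_exp_borel.
  elim: N => [|N IHN].
    by apply: bclos_ext (bclos_cst _ 0) => x; rewrite big_ord0.
  have cN : bclos exp_gen (expmax (N%:R * b)).
    by apply: bclos_gen; exists (N%:R * b) => //; rewrite mulr_ge0// ltW.
  by apply: bclos_ext (bclosD IHN cN) => x; rewrite big_ord_recr.
have hw N s : D s -> h N s * w s = \1_(I `&` A) s * (1 - expR (- (s * (N%:R * b)))).
  rewrite /= in_itv/= andbT => s0; rewrite /h -mulrA; congr (_ * _).
  elim: N => [|N IHN]; first by rewrite big_ord0 mul0r mul0r mulr0 oppr0 expR0 subrr.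
  rewrite big_ord_recr/= mulrDl IHN /expmax /w max_l// -natr1.
  by rewrite !(mulrDl, mulrDr) mul1r opprD expRD (mulrC _ s); ring.
have intE N : (\int[rho]_(s in D) (h N s * w s)%:E =
               \int[rho']_(s in D) (h N s * w s)%:E)%E.
  have [M hM] := bclos_bounded exp_gen_bounded (ch N).
  have mhN : measurable_fun [set: R] (h N).
    apply: bclos_measurable (bclos_exp_gen_upto b0 (ch N)); exact: mG.
  have f1 := integrable_fin_num itvcy_measurable (bounded_weight_integrable itvcy_measurable iw mhN hM).
  have f2 := integrable_fin_num itvcy_measurable (bounded_weight_integrable itvcy_measurable iw' mhN hM).
  by rewrite -[LHS]fineK// -[RHS]fineK//; congr EFin; exact: eh.
have cvgI (m : {measure set R -> \bar R}) :
    (\int[m]_(s in D) (h N s * w s)%:E @[N --> \oo] --> m (I `&` A))%E.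
  have -> : (m (I `&` A) = \int[m]_(s in D) (\1_(I `&` A) s)%:E)%E.
    rewrite integral_indic//; congr (m _); apply/esym/setIidPl.
    by move=> x []; rewrite /I/= !in_itv/= !andbT => /ltW.
  pose g (N : nat) (s : R) := (\1_(I `&` A) s * (1 - expR (- (s * (N%:R * b)))))%:E.
  rewrite (_ : (fun N => _) = (fun N => \int[m]_(s in D) g N s)%E); last first.
    by apply/funext => N; apply: eq_integral => s; rewrite inE => /hw ->.
  apply: cvg_nondecreasing_integral => //; rewrite /g.
  - move=> n; apply/measurable_EFinP; apply: measurable_funTS.
    apply: measurable_funM => //; exact: measurable_onem_exp.
  - move=> n s; rewrite /= in_itv/= andbT => s0; rewrite lee_fin mulr_ge0//.
    by rewrite subr_ge0 expR_le1 oppr_le0 !mulr_ge0// ltW.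
  - move=> s; rewrite /= in_itv/= andbT => s0 n k nk; rewrite lee_fin ler_wpM2l//.
    rewrite lerB// ler_expR lerN2 ler_wpM2l// ler_wpM2r ?(ltW b0)//.
    by rewrite ler_nat.
  - move=> s _; apply: cvg_EFin; first exact: nearW.
    rewrite indicE; case: (boolP (s \in I `&` A)) => [|_].
      rewrite inE => -[]; rewrite /I/= in_itv/= andbT => s0 _.
      rewrite -[X in _ --> X]mulr1; apply: cvgM; first exact: cvg_cst.
      rewrite -[X in _ --> X]subr0; apply: cvgB; first exact: cvg_cst.
      under eq_fun do rewrite mulrCA.
      by apply: cvg_expR_geo; rewrite mulr_gt0.
    by rewrite (_ : (fun n => _) = cst 0) ?mul0r; [exact: cvg_cst|apply/funext => n; rewrite mul0r].
have eIA : rho (I `&` A) = rho' (I `&` A).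
  have := cvgI rho.
  rewrite (_ : (fun N => _) = (fun N => \int[rho']_(s in D) (h N s * w s)%:E)%E).
    by move/cvg_unique; apply => //; exact: cvgI.
  by apply/funext => N; exact: intE.
have split_ (m : {measure set R -> \bar R}) : levy_domain m -> m A = m (I `&` A).
  move=> [m0 _].
  rewrite (measureDI m mA mI) setIC [X in (X + _)%E](_ : _ = 0%E) ?add0e//.
  apply/eqP; rewrite -measure_le0 -m0; apply: le_measure; rewrite ?inE//.
    exact: measurableD.
  by move=> x [_]; rewrite /I/= !in_itv/= andbT => /negP; rewrite -leNgt.
by rewrite (split_ rho)// (split_ rho').
Qed.

End LaplaceUniqueness.

(** * Convolutions and reflections *)

Section Laws.
Context {R : realType}.
Implicit Types (lam nu P Q : probability R R) (t : R).

Lemma law_exists d (T : measurableType d) (P : probability T R) (X : T -> R) :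
  measurable_fun [set: T] X ->
  exists Q : probability R R, forall A, measurable A -> Q A = P (X @^-1` A).
Proof.
move=> mX.
pose mX' := isMeasurableFun.Build _ _ _ _ _ mX.
pose X' : {mfun T >-> R} := MeasurableFun.Pack (MeasurableFun.Class mX').
by exists (distribution P X').
Qed.

Lemma Rintegral_law d (T : measurableType d) (P : probability T R) (X : T -> R)
    Q (f : R -> R) (M : R) :
  measurable_fun [set: T] X -> (forall A, measurable A -> Q A = P (X @^-1` A)) ->
  measurable_fun [set: R] f -> (forall x, `|f x| <= M) ->
  \int[Q]_x f x = \int[P]_x f (X x).
Proof.
move=> mX QP mf fM; congr fine.
pose mX' := isMeasurableFun.Build _ _ _ _ _ mX.
pose X' : {mfun T >-> R} := MeasurableFun.Pack (MeasurableFun.Class mX').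
rewrite (eq_measure_integral (distribution P X')) => [|A mA _]; last exact: QP.
rewrite integral_pushforward//; first exact/measurable_EFinP.
rewrite preimage_setT.
apply: (@probability_bounded_integrable _ _ _ P (f \o X) M) => [|x /=//].
exact: measurableT_comp.
Qed.

Lemma Rintegral_prod lam nu (f : R * R -> R) (M : R) :
  measurable_fun [set: R * R] f -> (forall z, `|f z| <= M) ->
  \int[(lam \x nu)%E]_z f z = \int[lam]_x \int[nu]_y f (x, y).
Proof.
move=> mf fM; congr fine.
have If : (lam \x nu)%E.-integrable setT (EFin \o f).
  exact: (probability_bounded_integrable (lam \x nu)%E mf fM).
rewrite -integral12_prod_meas1//; apply: eq_integral => x _.
rewrite /fubini_F fineK//; apply: integrable_fin_num => //.
apply: (@probability_bounded_integrable _ _ _ nu (fun y => f (x, y)) M) => //.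
exact: measurableT_comp.
Qed.

Lemma measurable_cosM t : measurable_fun [set: R] (fun x => cos (t * x)).
Proof. by apply: trig_gen_measurable; exists t; left. Qed.

Lemma measurable_sinM t : measurable_fun [set: R] (fun x => sin (t * x)).
Proof. by apply: trig_gen_measurable; exists t; right. Qed.

Lemma integrable_cosM P t : P.-integrable [set: R] (EFin \o (fun x => cos (t * x))).
Proof. by apply: trig_integrable; exists t; left. Qed.

Lemma integrable_sinM P t : P.-integrable [set: R] (EFin \o (fun x => sin (t * x))).
Proof. by apply: trig_integrable; exists t; right. Qed.

Lemma Rintegral_lin P (a b : R) (f g : R -> R) :
  P.-integrable [set: R] (EFin \o f) -> P.-integrable [set: R] (EFin \o g) ->
  \int[P]_x (a * f x + b * g x) = a * \int[P]_x f x + b * \int[P]_x g x.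
Proof.
move=> jf jg; rewrite -RintegralZl// -RintegralZl// -RintegralD//.
  exact: (integrableZl measurableT a jf).
exact: (integrableZl measurableT b jg).
Qed.

Definition fcos P t := \int[P]_x cos (t * x).
Definition fsin P t := \int[P]_x sin (t * x).

Lemma charfunE P t : charfun P t = (fcos P t +i* fsin P t)%C.
Proof. by []. Qed.

Lemma fcos_fsin_eq P Q : fcos P =1 fcos Q -> fsin P =1 fsin Q ->
  forall A, measurable A -> P A = Q A.
Proof. by move=> ec es; apply: probability_eq_trig. Qed.

Lemma conv_cos lam nu Q t : is_convolution lam nu Q ->
  fcos Q t = fcos lam t * fcos nu t - fsin lam t * fsin nu t.
Proof.
move=> cQ; have madd : measurable_fun [set: R * R] (fun p : R * R => p.1 + p.2).
  exact: measurable_funD.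
rewrite /fcos (Rintegral_law (P := (lam \x nu)%E) madd cQ (measurable_cosM t)
  (fun x => cos_max _)).
rewrite (@Rintegral_prod lam nu (fun p => cos (t * (p.1 + p.2))) 1); last first.
- by move=> z; exact: cos_max.
- by apply: (measurableT_comp (measurable_cosM t)).
have E x : \int[nu]_y cos (t * (x + y)) =
    fcos nu t * cos (t * x) + (- fsin nu t) * sin (t * x).
  rewrite mulNr mulrC (mulrC (fsin nu t)) -mulNr.
  rewrite -(Rintegral_lin _ _ (integrable_cosM nu t) (integrable_sinM nu t)).
  by apply: eq_Rintegral => y _; rewrite mulrDr cosD mulNr.
under eq_Rintegral do rewrite /= E.
rewrite Rintegral_lin; [|exact: integrable_cosM|exact: integrable_sinM].
by rewrite -/(fcos lam t) -/(fsin lam t) -/(fcos nu t) -/(fsin nu t); ring.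
Qed.

Lemma conv_sin lam nu Q t : is_convolution lam nu Q ->
  fsin Q t = fsin lam t * fcos nu t + fcos lam t * fsin nu t.
Proof.
move=> cQ; have madd : measurable_fun [set: R * R] (fun p : R * R => p.1 + p.2).
  exact: measurable_funD.
rewrite /fsin (Rintegral_law (P := (lam \x nu)%E) madd cQ (measurable_sinM t)
  (fun x => sin_max _)).
rewrite (@Rintegral_prod lam nu (fun p => sin (t * (p.1 + p.2))) 1); last first.
- by move=> z; exact: sin_max.
- by apply: (measurableT_comp (measurable_sinM t)).
have E x : \int[nu]_y sin (t * (x + y)) =
    fsin nu t * cos (t * x) + fcos nu t * sin (t * x).
  rewrite mulrC (mulrC (fcos nu t)) addrC.
  rewrite -(Rintegral_lin _ _ (integrable_cosM nu t) (integrable_sinM nu t)).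
  by apply: eq_Rintegral => y _; rewrite mulrDr sinD.
under eq_Rintegral do rewrite /= E.
rewrite Rintegral_lin; [|exact: integrable_cosM|exact: integrable_sinM].
by rewrite -/(fcos lam t) -/(fsin lam t) -/(fcos nu t) -/(fsin nu t); ring.
Qed.

Lemma conv_exists lam nu : exists Q, is_convolution lam nu Q.
Proof.
have madd : measurable_fun [set: R * R] (fun p : R * R => p.1 + p.2).
  exact: measurable_funD.
exact: (law_exists (lam \x nu)%E madd).
Qed.

Lemma reflection_exists P : exists Q,
  [/\ forall A, measurable A -> Q A = P (-%R @^-1` A),
      fcos Q =1 fcos P & fsin Q =1 fun t => - fsin P t].
Proof.
have mN : measurable_fun [set: R] (-%R : R -> R) by exact: measurable_funN.
have [Q hQ] := law_exists P mN; exists Q; split => // t.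
  rewrite /fcos (Rintegral_law mN hQ (measurable_cosM t) (fun x => cos_max _)).
  by apply: eq_Rintegral => x _; rewrite mulrN cosN.
rewrite /fsin (Rintegral_law mN hQ (measurable_sinM t) (fun x => sin_max _)).
rewrite -[RHS]mulN1r -RintegralZl//; last exact: integrable_sinM.
by apply: eq_Rintegral => x _; rewrite mulrN sinN mulN1r.
Qed.

End Laws.

(** * Weak limits of tight sequences *)

Section WeakLimits.
Context {R : realType}.
Implicit Types (P Q : probability R R) (F G : R -> R).

Definition dfun P (x : R) : R := fine (P `]-oo, x]%classic).

Lemma dfun_itv P (a b : R) : a <= b -> fine (P `]a, b]%classic) = dfun P b - dfun P a.
Proof.
move=> ab; rewrite /dfun -fineB ?fin_num_measure//; congr fine.
have -> : `]a, b]%classic = `]-oo, b] `\` `]-oo, a].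
  by rewrite -[RHS]setCK setCD setCitvl setUC -[LHS]setCK setCitv.
rewrite measureD ?setIidr//; first exact: subset_itvl.
by rewrite -ge0_fin_numE// fin_num_measure.
Qed.

Lemma dfun_ge0 P x : 0 <= dfun P x. Proof. exact: fine_ge0. Qed.

Lemma dfun_le1 P x : dfun P x <= 1.
Proof.
rewrite -lee_fin fineK ?fin_num_measure//.
exact: probability_le1.
Qed.

Lemma dfun_nd P : {homo dfun P : x y / x <= y}.
Proof. by move=> x y xy; rewrite -subr_ge0 -dfun_itv// fine_ge0. Qed.

Lemma distribution_function_exists G : nondecreasing G -> right_continuous G ->
  G @ -oo --> (0 : R) -> G @ +oo --> (1 : R) ->
  exists P, dfun P =1 G.
Proof.
move=> nd rc G0 G1.
pose C : cumulativeBounded (0 : R) 1 := HB.pack G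
  (isCumulative.Build R _ R G nd rc) (isCumulativeBounded.Build R 0 1 G G0 G1).
pose lsf := lebesgue_stieltjes_measure C.
(* The Lebesgue-Stieltjes measure lives on [measurableTypeR R]; the identity transports it to
   [R]. *)
have mid : measurable_fun [set: measurableTypeR R] (idfun : measurableTypeR R -> R).
  exact: measurable_id.
have [Q hQ] := law_exists (lsf : probability (measurableTypeR R) R) mid.
exists Q => x.
by rewrite /dfun hQ//; exact: (congr1 fine (cdf_lebesgue_stieltjes_id C x)).
Qed.

(** A Stieltjes sum sees F at finitely many points only, so it follows pointwise limits of
    distribution functions. *)
Definition riemann_sum (g F : R -> R) (a h : R) n : R :=
  \sum_(i < n) g (a + i%:R * h) * (F (a + i.+1%:R * h) - F (a + i%:R * h)).

Lemma riemann_sumS (g F : R -> R) a h n : riemann_sum g F a h n.+1 =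
  riemann_sum g F a h n +
  g (a + n%:R * h) * (F (a + n.+1%:R * h) - F (a + n%:R * h)).
Proof. by rewrite /riemann_sum big_ord_recr. Qed.

Lemma Rintegral_cell P (g : R -> R) (a b d : R) : a <= b ->
  measurable_fun [set: R] g -> (forall x, `|g x| <= 1) ->
  (forall x, a < x <= b -> `|g x - g a| <= d) ->
  `|\int[P]_(x in `]a, b]) g x - g a * (dfun P b - dfun P a)|
    <= d * (dfun P b - dfun P a).
Proof.
move=> ab mg g1 gd; rewrite -dfun_itv//.
have mI : measurable (`]a, b]%classic : set R) by exact: measurable_itv.
have ig : P.-integrable `]a, b] (EFin \o g).
  by apply: integrableS (probability_bounded_integrable P mg g1).
have ic (c : R) : P.-integrable `]a, b] (EFin \o cst c).
  exact: finite_measure_integrable_cst.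
rewrite -Rintegral_cst// -(Rintegral_cst P mI d) -RintegralB//; last exact: (ic (g a)).
have igc : P.-integrable `]a, b] (EFin \o (fun x => g x - g a)).
  exact: (integrableB mI ig (ic _)).
apply: le_trans (le_normr_Rintegral mI igc) _.
apply: le_Rintegral => //.
- exact: (integrable_norm igc).
- exact: (ic d).
Qed.

(** The oscillation of g on the cells costs d; the rest is the mass outside the mesh, where g is
    only bounded by 1. *)
Lemma Rintegral_riemann_sum P (g : R -> R) (a h d : R) n : 0 < h ->
  measurable_fun [set: R] g -> (forall x, `|g x| <= 1) ->
  (forall x y, `|x - y| <= h -> `|g x - g y| <= d) ->
  `|\int[P]_x g x - riemann_sum g (dfun P) a h n| <=
    d + (1 - (dfun P (a + n%:R * h) - dfun P a)).
Proof.
move=> h0 mg g1 gd.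
have d0 : 0 <= d by apply: le_trans (gd 0 0 _); rewrite subrr normr0 ?(ltW h0).
have ig D : measurable D -> P.-integrable D (EFin \o g).
  by move=> mD; apply: integrableS (probability_bounded_integrable P mg g1).
have nh k : a <= a + k%:R * h by rewrite lerDl mulr_ge0// ltW.
have IH k : `|\int[P]_(x in `]a, (a + k%:R * h)]) g x - riemann_sum g (dfun P) a h k|
    <= d * (dfun P (a + k%:R * h) - dfun P a).
  elim: k => [|k IHk].
    rewrite mul0r addr0 set_itv_ge ?bnd_simp ?ltxx// Rintegral_set0.
    by rewrite /riemann_sum big_ord0 !subrr normr0 mulr0.
  have kk : a + k%:R * h <= a + k.+1%:R * h.
    by rewrite lerD2l ler_wpM2r ?ler_nat// ltW.
  have cell := @Rintegral_cell P g _ _ d kk mg g1.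
  have -> : `]a, (a + k.+1%:R * h)]%classic =
      `]a, (a + k%:R * h)] `|` `](a + k%:R * h), (a + k.+1%:R * h)] :> set R.
    by rewrite -itv_bndbnd_setU// bnd_simp.
  rewrite Rintegral_setU; first last.
  - apply/disj_setPS => x [/=]; rewrite !in_itv/= => /andP[_ xk] /andP[kx _].
    by move: (lt_le_trans kx xk); rewrite ltxx.
  - by apply: ig; apply: measurableU; exact: measurable_itv.
  - exact: measurable_itv.
  - exact: measurable_itv.
  rewrite riemann_sumS opprD addrACA; apply: le_trans (ler_normD _ _) _.
  apply: le_trans (lerD IHk (cell _)) _; last by lra.
  move=> x /andP[kx xk]; apply: gd; rewrite ger0_norm ?subr_ge0 ?(ltW kx)//.
  by move: xk; rewrite -natr1; lra.
have mI : measurable (`]a, (a + n%:R * h)]%classic : set R) by exact: measurable_itv.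
have -> : \int[P]_x g x = \int[P]_(x in `]a, (a + n%:R * h)]) g x +
    \int[P]_(x in ~` `]a, (a + n%:R * h)]) g x.
  rewrite -Rintegral_setU ?setUv//; first exact: measurableC.
    exact: ig.
  by apply/disj_setPS; rewrite setICr.
have out : `|\int[P]_(x in ~` `]a, (a + n%:R * h)]) g x| <=
    1 - (dfun P (a + n%:R * h) - dfun P a).
  have mC := measurableC mI.
  apply: le_trans (le_normr_Rintegral mC (ig _ mC)) _.
  rewrite -dfun_itv//.
  have -> : 1 - fine (P `]a, (a + n%:R * h)]%classic) = fine (P (~` `]a, (a + n%:R * h)])).
    rewrite -[1]/(fine 1%E) -fineB ?fin_num_measure//.
    by rewrite -probability_setC.
  rewrite -[leRHS]mul1r -Rintegral_cst//; apply: le_Rintegral => //.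
  - by apply: integrable_norm; exact: ig.
  - exact: finite_measure_integrable_cst.
rewrite addrAC; apply: le_trans (ler_normD _ _) _; apply: lerD out.
apply: le_trans (IH n) _; rewrite ler_piMr//.
by have := dfun_le1 P (a + n%:R * h); have := dfun_ge0 P a; lra.
Qed.

(* Summation by parts; F and G only differ at jumps, so the differences
   G - F at the mesh points telescope. *)
Lemma riemann_sum_dist (g F G : R -> R) (a h d : R) n : 0 < h ->
  (forall x, `|g x| <= 1) ->
  (forall x y, `|x - y| <= h -> `|g x - g y| <= d) ->
  (forall x, 0 <= F x <= 1) -> (forall x, F x <= G x) ->
  (forall x y, x < y -> G x <= F y) ->
  `|riemann_sum g G a h n - riemann_sum g F a h n| <=
    d + (G (a + n%:R * h) - F (a + n%:R * h)) + (G a - F a).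
Proof.
move=> h0 g1 gd F01 FG GF.
have d0 : 0 <= d by apply: le_trans (gd 0 0 _); rewrite subrr normr0 ?(ltW h0).
pose p i : R := a + i%:R * h.
have pS i : p i < p i.+1 by rewrite /p -natr1 mulrDl mul1r addrA ltrDl.
pose e i := G (p i) - F (p i).
have e0 i : 0 <= e i by rewrite subr_ge0.
have main k : `|(riemann_sum g G a h k - riemann_sum g F a h k) - g (p k) * e k
    + g (p 0%N) * e 0%N| <= d * (F (p k.+1) - F (p 0%N)).
  elim: k => [|k IHk].
    rewrite /riemann_sum !big_ord0 subrr sub0r addNr normr0 mulr_ge0// subr_ge0.
    by apply: le_trans (FG _) _; exact: GF.
  rewrite !riemann_sumS -!/(p _).
  rewrite (_ : _ + _ = (riemann_sum g G a h k - riemann_sum g F a h k - g (p k) * e k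
    + g (p 0%N) * e 0%N) + (g (p k) - g (p k.+1)) * e k.+1); last by rewrite /e; ring.
  apply: le_trans (ler_normD _ _) _.
  have -> : d * (F (p k.+2) - F (p 0%N)) =
    d * (F (p k.+1) - F (p 0%N)) + d * (F (p k.+2) - F (p k.+1)) by ring.
  (* [e k.+1] is at most the increment of F over the next cell, because G at a mesh point is below F
     at the next one. *)
  apply: lerD IHk _; rewrite normrM ler_pM//.
    apply: gd; rewrite (_ : p k - p k.+1 = - h) ?normrN ?ger0_norm ?(ltW h0)//.
    by rewrite /p -natr1; ring.
  by rewrite ger0_norm// lerB// GF.
have p0 : p 0%N = a by rewrite /p mul0r addr0.
have := main n; rewrite p0.
have n1 : `|g (p n) * e n| <= e n by rewrite normrM (ger0_norm (e0 n)) ler_piMl.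
have n2 : `|g a * e 0%N| <= e 0%N by rewrite normrM (ger0_norm (e0 _)) ler_piMl.
have n3 : d * (F (p n.+1) - F a) <= d.
  by rewrite ler_piMr//; have /andP[] := F01 (p n.+1); have /andP[] := F01 a; lra.
rewrite -/(p n) -[G (p n) - _]/(e n).
have -> : G a - F a = e 0%N by rewrite /e p0.
move: n1 n2; rewrite !ler_norml; lra.
Qed.

End WeakLimits.

(** * Ultrafilter limits of distribution functions *)

Section Helly.
Context {R : realType}.
Variable lam : nat -> probability R R.
Hypothesis tight : forall e : R, 0 < e ->
  exists M, forall k, 1 - (dfun (lam k) M - dfun (lam k) (- M)) <= e.

(** An ultrafilter on the compact [0, 1] has a cluster point and converges to it. One ultrafilter
    serves all x at once, so no diagonal subsequence is extracted. *)
Lemma ultra_cvg_dfun (U : set_system nat) : UltraFilter U ->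
  forall x, exists l : R, dfun (lam k) x @[k --> U] --> l.
Proof.
move=> UU x; set f := fun k => dfun (lam k) x.
have [l [_ cl]] : `[0, 1]%classic `&` cluster (f @ U) !=set0.
  apply: (@segment_compact R 0 1).
  suff : U [set k | f k \in `[0, 1]] by [].
  by apply: filterE => k; rewrite /= in_itv/= dfun_ge0 dfun_le1.
exists l => N Nl /=; have [//|UN] := in_ultra_setVsetC (f @^-1` N) UU.
by have [y [/= nNy Ny]] := cl (~` N) N UN Nl.
Qed.

Section UltraLimit.
Context (U : set_system nat) {UU : UltraFilter U}.

Definition ulim (x : R) : R := projT1 (cid (ultra_cvg_dfun UU x)).

Lemma ulimP x : dfun (lam k) x @[k --> U] --> ulim x.
Proof. exact: (projT2 (cid (ultra_cvg_dfun UU x))). Qed.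

Lemma ulim01 x : 0 <= ulim x <= 1.
Proof.
apply/andP; split; [apply: (cvgr_to_ge (@ulimP x))|apply: (cvgr_to_le (@ulimP x))].
  by apply: nearW => k; exact: dfun_ge0.
by apply: nearW => k; exact: dfun_le1.
Qed.

Lemma ulim_nd : {homo ulim : x y / x <= y}.
Proof.
move=> x y xy; apply: (ler_cvg_to (@ulimP x) (@ulimP y)).
by apply: nearW => k; exact: dfun_nd.
Qed.

Lemma ulim_tail e : 0 < e -> exists M, [/\
  forall k, 1 - (dfun (lam k) M - dfun (lam k) (- M)) <= e,
  ulim (- M) <= e & 1 - e <= ulim M].
Proof.
move=> /tight[M hM]; exists M; split => //.
  apply: (cvgr_to_le (@ulimP _)); apply: nearW => k.
  by have := hM k; have := dfun_le1 (lam k) M; lra.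
apply: (cvgr_to_ge (@ulimP _)); apply: nearW => k.
by have := hM k; have := dfun_ge0 (lam k) (- M); lra.
Qed.

(** The pointwise limit is monotone but can fail to be right-continuous; its limit from the right is
    what a distribution function can be. *)
Definition rlim (x : R) : R := inf (ulim @` `]x, +oo[).

Let rlim_has_lbound x : has_lbound (ulim @` `]x, +oo[).
Proof. by exists 0 => _ [y _ <-]; case/andP: (ulim01 y). Qed.

Let rlim_nonempty x : (ulim @` `]x, +oo[) !=set0.
Proof. by exists (ulim (x + 1)), (x + 1) => //=; rewrite in_itv/= ltrDl ltr01. Qed.

Lemma le_ulim_rlim x : ulim x <= rlim x.
Proof.
apply: lb_le_inf => // _ [y + <-]; rewrite /= in_itv/= andbT => /ltW.
exact: ulim_nd.
Qed.

Lemma rlim_le_ulim x y : x < y -> rlim x <= ulim y.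
Proof. by move=> xy; apply: ge_inf => //; exists y => //=; rewrite in_itv/= xy. Qed.

Lemma rlim_nd : {homo rlim : x y / x <= y}.
Proof.
move=> x y xy; apply: lb_le_inf => // _ [z + <-]; rewrite /= in_itv/= andbT => yz.
by apply: rlim_le_ulim; exact: le_lt_trans yz.
Qed.

Lemma rlim_le1 x : rlim x <= 1.
Proof.
apply: (le_trans (@rlim_le_ulim x (x + 1) _)); first by rewrite ltrDl.
by case/andP: (ulim01 (x + 1)).
Qed.

Lemma rlim_ge0 x : 0 <= rlim x.
Proof. by apply: le_trans (le_ulim_rlim x); case/andP: (ulim01 x). Qed.

Lemma rlim_right_continuous : right_continuous rlim.
Proof.
move=> x; apply/cvgrPdist_le => e e0.
have [_ [z + <-] ze] := inf_adherent e0 (conj (rlim_nonempty x) (rlim_has_lbound x)).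
rewrite /= in_itv/= andbT => xz.
near=> y.
have xy : x < y by near: y; exact: nbhs_right_gt.
have yz : y < z by near: y; exact: nbhs_right_lt.
rewrite distrC ger0_norm ?subr_ge0; last exact/rlim_nd/ltW.
rewrite lerBlDl; apply: (le_trans (rlim_le_ulim yz)); exact: ltW.
Unshelve. all: by end_near. Qed.

Lemma rlim_cvg_pinfty : rlim @ +oo --> (1 : R).
Proof.
apply/cvgrPdist_le => e e0; have [M [_ _ hM]] := ulim_tail e0.
near=> y; rewrite ger0_norm ?subr_ge0 ?rlim_le1//.
have My : M <= y by near: y; apply: nbhs_pinfty_ge; exact: num_real.
by have := le_ulim_rlim y; have := ulim_nd My; lra.
Unshelve. all: by end_near. Qed.

Lemma rlim_cvg_ninfty : rlim @ -oo --> (0 : R).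
Proof.
apply/cvgrPdist_le => e e0; have [M [_ hM _]] := ulim_tail e0.
near=> y; rewrite sub0r normrN ger0_norm ?rlim_ge0//.
have yM : y < - M by near: y; apply: nbhs_ninfty_lt; exact: num_real.
by have := rlim_le_ulim yM; lra.
Unshelve. all: by end_near. Qed.

Lemma cvg_riemann_sum (g : R -> R) (a h : R) n :
  riemann_sum g (dfun (lam k)) a h n @[k --> U] --> riemann_sum g ulim a h n.
Proof.
elim: n => [|n IHn].
  rewrite /riemann_sum big_ord0 (_ : (fun k => _) = cst 0); first exact: cvg_cst.
  by apply/funext => k; rewrite big_ord0.
rewrite riemann_sumS (_ : (fun k => _) = (fun k => riemann_sum g (dfun (lam k)) a h n +
  g (a + n%:R * h) * (dfun (lam k) (a + n.+1%:R * h) - dfun (lam k) (a + n%:R * h)))).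
  apply: cvgD => //; apply: cvgM; first exact: cvg_cst.
  by apply: cvgB; exact: ulimP.
by apply/funext => k; rewrite riemann_sumS.
Qed.

Lemma weak_ultra_limit : exists nu : probability R R, forall g : R -> R,
  measurable_fun [set: R] g -> (forall x, `|g x| <= 1) ->
  (forall d, 0 < d ->
    exists2 h, 0 < h & forall x y, `|x - y| <= h -> `|g x - g y| <= d) ->
  \int[lam k]_x g x @[k --> U] --> \int[nu]_x g x.
Proof.
have [nu hnu] := distribution_function_exists rlim_nd rlim_right_continuous
  rlim_cvg_ninfty rlim_cvg_pinfty.
exists nu => g mg g1 ug; apply/cvgrPdist_le => e e0.
(* The error budget: 3 d between the integral for [nu] and its sum, 3 d from [rlim] to [ulim], d for
   the ultrafilter limit, 2 d for [lam k]. *)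
pose d := e / 9; have d0 : 0 < d by rewrite divr_gt0.
have [h h0 gd] := ug _ d0.
have [M [tM uM1 uM2]] := ulim_tail d0.
(* Strictly left of - M, so that [rlim a] is at most [ulim (- M)], hence at most d. *)
pose a := - M - h.
have [n Mn] : exists n : nat, M <= a + n%:R * h.
  exists (Num.truncn ((M - a) / h)).+1.
  have := truncnS_gt ((M - a) / h); rewrite ltr_pdivrMr// => ?; lra.
have aM : a < - M by rewrite /a; lra.
have r1 := Rintegral_riemann_sum nu a n h0 mg g1 gd.
have hn : dfun nu = rlim by apply/funext.
rewrite hn in r1.
have r2 := riemann_sum_dist a n h0 g1 gd ulim01 le_ulim_rlim rlim_le_ulim.
near=> k.
have r3 : `|riemann_sum g ulim a h n - riemann_sum g (dfun (lam k)) a h n| <= d.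
  near: k; move: d d0 {gd uM1 uM2 tM r1 r2}; apply/cvgrPdist_le.
  exact: cvg_riemann_sum.
have r4 := Rintegral_riemann_sum (lam k) a n h0 mg g1 gd.
have t1 := tM k; have t2 := dfun_nd (lam k) Mn; have t3 := dfun_nd (lam k) (ltW aM).
have u1 := ulim_nd Mn; have u2 := rlim_le_ulim aM.
have u3 := le_ulim_rlim (a + n%:R * h); have u4 := rlim_le1 (a + n%:R * h).
have /andP[u5 _] := ulim01 a; have := rlim_ge0 a.
move: r1 r2 r3 r4; rewrite !ler_norml; rewrite (_ : e = 9 * d); last by rewrite /d; field.
lra.
Unshelve. all: by end_near. Qed.

End UltraLimit.
End Helly.

(** * Convolution powers of a symmetric infinitely divisible law *)

Section CharacteristicFunctions.
Context {R : realType}.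
Implicit Types (P Q : probability R R).

Lemma fcos0 P : fcos P 0 = 1.
Proof.
rewrite -[RHS](Rintegral_probability_cst P).
by apply: eq_Rintegral => x _; rewrite mul0r cos0.
Qed.

Lemma fcosN P t : fcos P (- t) = fcos P t.
Proof. by apply: eq_Rintegral => x _; rewrite mulNr cosN. Qed.

Lemma fcos_abs P t : fcos P `|t| = fcos P t.
Proof. by have [_|_] := ger0P t; rewrite ?fcosN. Qed.

Lemma fcos_le1 P t : fcos P t <= 1.
Proof.
rewrite -[leRHS](Rintegral_probability_cst P); apply: le_Rintegral => //.
  exact: integrable_cosM.
exact: finite_measure_integrable_cst.
Qed.

Lemma continuous_fcos P : continuous (fcos P).
Proof.
move=> t; apply/(@cvg_nbhsP _ R^o) => u ut.
apply: (@cvg_Rintegral_bounded _ P (fun n x => cos (u n * x)) _ 1).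
- by move=> n; exact: measurable_cosM.
- by move=> n x; exact: cos_max.
- move=> x; apply: continuous_cvg; first exact: continuous_cos.
  by apply: cvgM => //; exact: cvg_cst.
Qed.

(** Integrate 1 - cos (2 y) = 2 (1 - cos y) (1 + cos y) <= 4 (1 - cos y). A characteristic function
    close to 1 at t thus cannot vanish at 2 t. *)
Lemma fcos_double P t : 1 - fcos P (2 * t) <= 4 * (1 - fcos P t).
Proof.
have one : P.-integrable [set: R] (EFin \o (fun=> 1 : R)).
  exact: finite_measure_integrable_cst.
have E u : 1 - fcos P u = \int[P]_x (1 * 1 + (-1) * cos (u * x)).
  rewrite (Rintegral_lin 1 (-1) one (integrable_cosM P u)).
  by rewrite (Rintegral_probability_cst P) -/(fcos P u); ring.
rewrite !E -RintegralZl//; last first.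
  apply: (@probability_bounded_integrable _ _ _ P
    (fun x => 1 * 1 + (-1) * cos (t * x)) 2).
    by apply: measurable_funD => //; apply: measurable_funM => //; exact: measurable_cosM.
  move=> x; have := cos_max (t * x); rewrite !ler_norml; lra.
apply: le_Rintegral => //.
- apply: (@probability_bounded_integrable _ _ _ P
    (fun x => 1 * 1 + (-1) * cos (2 * t * x)) 2).
    by apply: measurable_funD => //; apply: measurable_funM => //; exact: measurable_cosM.
  move=> x; have := cos_max (2 * t * x); rewrite !ler_norml; lra.
- apply: (@probability_bounded_integrable _ _ _ P
    (fun x => 4 * (1 * 1 + (-1) * cos (t * x))) 8).
    apply: measurable_funM => //.
    by apply: measurable_funD => //; apply: measurable_funM => //; exact: measurable_cosM.
  move=> x; have := cos_max (t * x); rewrite !ler_norml; lra.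
- move=> x _; rewrite -mulrA mulr_natl cos_mulr2n.
  have := cos_max (t * x); rewrite !ler_norml => /andP[h1 h2]; nra.
Qed.

Lemma symmetric_fsin P : symmetric_law P -> fsin P =1 fun=> 0.
Proof.
move=> symP t; have [Q [hQ _ sQ]] := reflection_exists P.
have e : fsin Q t = fsin P t.
  congr fine; apply: eq_measure_integral => A mA _.
  apply: etrans (symP A mA); apply: etrans (hQ A mA) _; congr (P _).
  apply/seteqP; split => x /=; first by move=> Ax; exists (- x) => //; rewrite opprK.
  by move=> [y Ay <-]; rewrite opprK.
by have := sQ t; rewrite e; lra.
Qed.

(** Squared moduli multiply under convolution; they avoid the phase of [nu], which is unknown as
    [nu] need not be symmetric. *)
Lemma convpow_modulus nu n P t : convpow nu n P ->
  fcos P t ^+ 2 + fsin P t ^+ 2 = (fcos nu t ^+ 2 + fsin nu t ^+ 2) ^+ n.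
Proof.
elim => [|{}n lam {}P _ IH cP]; first by rewrite expr1.
by rewrite [RHS]exprSr -IH (conv_cos _ cP) (conv_sin _ cP); ring.
Qed.

(** Take the convolution of an n-th root with its reflection: its characteristic function is the
    squared modulus, hence real and nonnegative, but it is a root of the square. *)
Lemma symmetric_root P n : infinitely_divisible P -> fsin P =1 (fun=> 0) ->
  (0 < n)%N -> exists Q, [/\ fsin Q =1 fun=> 0, forall t, 0 <= fcos Q t &
    forall t, fcos Q t ^+ n = fcos P t ^+ 2].
Proof.
move=> idP sP n0; have [nu cnu] := idP n n0.
have [nu' [_ c' s']] := reflection_exists nu.
have [Q cQ] := conv_exists nu nu'.
have cosQ t : fcos Q t = fcos nu t ^+ 2 + fsin nu t ^+ 2.
  by rewrite (conv_cos _ cQ) c' s'; ring.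
exists Q; split => t.
- by rewrite (conv_sin _ cQ) c' s'; ring.
- by rewrite cosQ addr_ge0// sqr_ge0.
- by rewrite cosQ -(convpow_modulus t cnu) sP expr0n addr0.
Qed.

Lemma dirac_charfun : exists P : probability R R,
  [/\ forall A, measurable A -> P A = \d_(0 : R) A, fcos P =1 (fun=> 1) & fsin P =1 (fun=> 0)].
Proof.
have dE (f : R -> R) : measurable_fun [set: R] f ->
    \int[\d_(0 : R) : probability R R]_x f x = f 0.
  move=> mf; rewrite /Rintegral integral_dirac//; last exact/measurable_EFinP.
  by rewrite diracT mul1e.
exists (\d_(0 : R) : probability R R); split => // t.
  by apply: etrans (dE _ (measurable_cosM t)) _; rewrite mulr0 cos0.
by apply: etrans (dE _ (measurable_sinM t)) _; rewrite mulr0 sin0.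
Qed.

Lemma symmetric_pow P n : fsin P =1 (fun=> 0) ->
  exists Q, fsin Q =1 (fun=> 0) /\ forall t, fcos Q t = fcos P t ^+ n.
Proof.
move=> sP; elim: n => [|n [Q [sQ cQ]]].
  by have [Q [_ cQ sQ]] := dirac_charfun; exists Q; split => // t; rewrite cQ expr0.
have [S cS] := conv_exists P Q; exists S; split => t.
  by rewrite (conv_sin _ cS) sP sQ; ring.
by rewrite (conv_cos _ cS) sP sQ cQ exprS; ring.
Qed.

(** A zero at 2 u is a zero of every root there, so by [fcos_double] each root is at most 3/4 at u,
    and the n-th powers force a zero at u. Halving repeatedly would bring zeros arbitrarily close to
    0, where the value is 1. *)
Lemma fcos_neq0 P t : infinitely_divisible P -> fsin P =1 (fun=> 0) ->
  fcos P t != 0.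
Proof.
move=> idP sP.
have double u : fcos P u != 0 -> fcos P (2 * u) != 0.
  apply: contra_neq => fu0.
  have bnd n : fcos P u ^+ 2 <= (3 / 4) ^+ n.+1.
    have [Q [_ Q0 Qn]] := symmetric_root idP sP (ltn0Sn n).
    rewrite -Qn lerXn2r ?nnegrE// ?divr_ge0//.
    have : fcos Q (2 * u) ^+ n.+1 == 0 by rewrite Qn fu0 expr0n.
    rewrite expf_eq0/= => /eqP.
    by have := fcos_double Q u; lra.
  have c0 : (fun n => (3 / 4 : R) ^+ n.+1) @ \oo --> (0 : R).
    rewrite (cvg_shiftS (fun n => (3 / 4 : R) ^+ n)).
    by apply: cvg_expr; rewrite ger0_norm ?divr_ge0//; lra.
  have f0 : fcos P u ^+ 2 <= 0 by apply: (cvgr_to_ge c0); exact: nearW.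
  by apply/eqP; rewrite -sqrf_eq0 eq_le f0 sqr_ge0.
have : \forall u \near (0 : R), 0 < fcos P u.
  by apply: (cvgr_gt _ (@continuous_fcos P 0)); rewrite fcos0.
move=> /nbhs_ballP[e /= e0 he].
have small n : `|t / 2 ^+ n| < e -> fcos P t != 0.
  move=> te; have : fcos P (t / 2 ^+ n) != 0.
    by rewrite gt_eqF// he//= /ball/= sub0r normrN.
  elim: n {te} => [|n IHn]; first by rewrite expr0 divr1.
  move/double => h; apply: IHn; rewrite (_ : t / _ = 2 * (t / 2 ^+ n.+1))//.
  by rewrite exprS; field; rewrite expf_neq0.
have c0 : `|t / 2 ^+ n| @[n --> \oo] --> (0 : R).
  rewrite -(normr0 R); apply: cvg_norm.
  rewrite (_ : (fun n => _) = (fun n => t * 2^-1 ^+ n)); last first.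
    by apply/funext => n; rewrite exprVn.
  rewrite -[X in _ --> X](mulr0 t); apply: cvgM; first exact: cvg_cst.
  by apply: cvg_expr; rewrite ger0_norm ?invr_ge0//; lra.
have [n _ /(_ n (leqnn n))] := cvgr_lt _ c0 _ e0.
exact: small.
Qed.

Lemma fcos_gt0 P t : infinitely_divisible P -> fsin P =1 (fun=> 0) ->
  0 < fcos P t.
Proof.
move=> idP sP; rewrite lt_neqAle eq_sym fcos_neq0//= leNgt; apply/negP => ft.
rewrite -fcos_abs in ft.
have [c _ /eqP] : exists2 c, c \in `[0, `|t|] & fcos P c = 0.
  apply: IVT => //.
    exact/continuous_subspaceT/continuous_fcos.
  by rewrite fcos0 ge_min le_max (ltW ft) ler01 orbT.
by apply/negP; exact: fcos_neq0.
Qed.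

Definition psi P (t : R) : R := - ln (fcos P t).

Lemma psi_ge0 P t : 0 <= psi P t.
Proof. by rewrite oppr_ge0 ln_le0// fcos_le1. Qed.

Lemma psi0 P : psi P 0 = 0.
Proof. by rewrite /psi fcos0 ln1 oppr0. Qed.

Section Powers.
Variable P : probability R R.
Hypotheses (idP : infinitely_divisible P) (sP : fsin P =1 (fun=> 0)).

Lemma expR_psi t : expR (- psi P t) = fcos P t.
Proof. by rewrite opprK lnK// posrE fcos_gt0. Qed.

Lemma continuous_psi : continuous (psi P).
Proof.
move=> t; rewrite /continuous_at /psi; apply: cvgN; apply: continuous_cvg.
  by apply: continuous_ln; exact: fcos_gt0.
exact: continuous_fcos.
Qed.

Definition is_power (s : R) Q :=
  fsin Q =1 (fun=> 0) /\ forall t, fcos Q t = expR (- (s * psi P t)).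

(** The factor 2 is inherited from [symmetric_root]; the exponents 2 m / n still exhaust the
    nonnegative rationals. *)
Lemma rational_power m n : (0 < n)%N ->
  exists Q, is_power (2 * m%:R / n%:R) Q.
Proof.
move=> n0; have [S [sS S0 Sn]] := symmetric_root idP sP n0.
have [Q [sQ cQ]] := symmetric_pow m sS; exists Q; split => // t.
have n0' : (n%:R : R) != 0 by rewrite pnatr_eq0 -lt0n.
rewrite cQ (_ : fcos S t = expR (- (2 / n%:R * psi P t))).
  by rewrite -expRM_natl; congr expR; field.
apply: (pexpIrn n0); rewrite ?nnegrE ?expR_ge0//.
rewrite Sn -expR_psi -!expRM_natl; congr expR; by field.
Qed.

End Powers.
End CharacteristicFunctions.

(** * Real convolution powers by tightness *)

Section RealPowers.
Context {R : realType}.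
Implicit Types (P Q lam nu kap : probability R R).

Definition far (a : R) : set R := [set x | a <= `|x|].

Lemma measurable_far a : measurable (far a).
Proof.
rewrite (_ : far a = (@Num.norm _ R) @^-1` `[a, +oo[); last first.
  by apply/seteqP; split => x; rewrite /far/= in_itv/= andbT.
by rewrite -[_ @^-1` _]setTI; apply: normr_measurable.
Qed.

Lemma measurable_addp : measurable_fun [set: R * R] (fun p : R * R => p.1 + p.2).
Proof. exact: measurable_funD. Qed.

Lemma measurable_subp : measurable_fun [set: R * R] (fun p : R * R => p.1 - p.2).
Proof. exact: measurable_funB. Qed.

(* Levy's symmetrization inequality: 2 x = (x + y) + (x - y), and x + y and
   x - y have the same law under the product of symmetric laws. *)
Lemma symmetric_far_le lam nu kap a :
  fsin lam =1 (fun=> 0) -> fsin nu =1 (fun=> 0) -> fsin kap =1 (fun=> 0) ->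
  (forall t, fcos kap t = fcos lam t * fcos nu t) ->
  fine (lam (far a)) <= 2 * fine (kap (far a)).
Proof.
move=> sl sn sk ck.
have mB := measurable_far a.
pose pr := (lam \x nu)%E.
have addE A : measurable A -> pr ((fun p : R * R => p.1 + p.2) @^-1` A) = kap A.
  move=> mA; have [Q cQ] := conv_exists lam nu.
  apply: etrans (esym (cQ A mA)) _; apply: fcos_fsin_eq => // t.
    by rewrite (conv_cos _ cQ) sl sn ck; ring.
  by rewrite (conv_sin _ cQ) sl sn sk; ring.
(* The difference is a convolution with the reflection of [nu], whose characteristic function is
   that of [nu]. *)
have subE A : measurable A -> pr ((fun p : R * R => p.1 - p.2) @^-1` A) = kap A.
  move=> mA; have [nu' [hn cn sn']] := reflection_exists nu.
  have [Q cQ] := conv_exists lam nu'.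
  have -> : pr ((fun p : R * R => p.1 - p.2) @^-1` A) = Q A.
    apply: etrans _ (esym (cQ A mA)); rewrite /pr /product_measure1.
    apply: eq_integral => x _ /=.
    have mx : measurable (xsection ((fun p : R * R => p.1 + p.2) @^-1` A) x).
      apply: measurable_xsection; rewrite -[_ @^-1` _]setTI.
      exact: measurable_addp.
    by rewrite (hn _ mx).
  apply: fcos_fsin_eq => // t.
    by rewrite (conv_cos _ cQ) sl cn ck; ring.
  by rewrite (conv_sin _ cQ) sl sk cn sn' sn; ring.
have madd : measurable ((fun p : R * R => p.1 + p.2) @^-1` far a).
  by rewrite -[_ @^-1` _]setTI; exact: measurable_addp.
have msub : measurable ((fun p : R * R => p.1 - p.2) @^-1` far a).
  by rewrite -[_ @^-1` _]setTI; exact: measurable_subp.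
have le : (lam (far a) <= kap (far a) + kap (far a))%E.
  rewrite -{1}(addE _ mB) -(subE _ mB).
  apply: le_trans (measureU2 _ madd msub).
  have -> : lam (far a) = pr (far a `*` setT).
    rewrite /pr product_measure1E// [X in (_ * X)%E](_ : _ = 1%E) ?mule1//.
    exact: probability_setT.
  apply: le_measure; rewrite ?inE; [exact: measurableX|exact: measurableU|].
  move=> [x y] [/= ax _]; rewrite /far/=.
  have [h|h] := leP a `|x + y|; [by left|right].
  have : `|2 * x| <= `|x + y| + `|x - y|.
    by rewrite (_ : 2 * x = (x + y) + (x - y)); [exact: ler_normD|ring].
  by rewrite normrM ger0_norm//; move: ax h; rewrite /far/=; lra.
rewrite -lee_fin EFinM !fineK ?fin_num_measure//.
by rewrite mule_natl mule2n.
Qed.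

Lemma far_cvg0 P : fine (P (far n%:R)) @[n --> \oo] --> (0 : R).
Proof.
have : P (far n%:R) @[n --> \oo] --> P (\bigcap_n far n%:R).
  apply: nonincreasing_cvg_mu.
  - by rewrite ltey_eq fin_num_measure//; exact: measurable_far.
  - by move=> n; exact: measurable_far.
  - by apply: bigcap_measurable => // n _; exact: measurable_far.
  - move=> m n mn; apply/subsetPset => x; rewrite /far/=; apply: le_trans.
    by rewrite ler_nat.
rewrite (_ : \bigcap_n _ = set0); last first.
  rewrite -subset0 => x /(_ (Num.truncn `|x|).+1 Logic.I); rewrite /far/= leNgt.
  by rewrite truncnS_gt.
by rewrite measure0 => /fine_cvg.
Qed.

Lemma dfun_far P (M : R) : 0 <= M ->
  1 - (dfun P M - dfun P (- M)) <= fine (P (far M)).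
Proof.
move=> M0; rewrite -dfun_itv; last by rewrite -subr_ge0 opprK addr_ge0.
have mI : measurable (`]- M, M]%classic : set R) by exact: measurable_itv.
have mf := measurable_far M.
have -> : 1 - fine (P `]- M, M]%classic) = fine (P (~` `]- M, M])).
  rewrite -[1]/(fine 1%E) -fineB ?fin_num_measure//.
  by rewrite -probability_setC.
apply: fine_le; rewrite ?fin_num_measure//; first exact: measurableC.
apply: le_measure; rewrite ?inE//; first exact: measurableC.
move=> x /= /negP; rewrite in_itv/= negb_and -leNgt -ltNge /far/= => /orP[h|h].
  by rewrite lerNr in h; apply: le_trans h _; rewrite -normrN ler_norm.
by apply: le_trans (ltW h) (ler_norm _).
Qed.

(** The addition formulas bound both increments by |cos (t u) - 1| + |sin (t u)| with u = x - y, so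
    continuity at 0 is enough. *)
Lemma uniformly_continuous_trig (t d : R) : 0 < d ->
  exists2 h, 0 < h &
  forall x y, `|x - y| <= h ->
    `|cos (t * x) - cos (t * y)| <= d /\ `|sin (t * x) - sin (t * y)| <= d.
Proof.
move=> d0.
have c : (`|cos (t * u) - 1| + `|sin (t * u)|) @[u --> (0 : R)] --> (0 : R).
  have ct : t * u @[u --> (0 : R)] --> (0 : R).
    by rewrite -[X in _ --> X](mulr0 t); exact: mulrl_continuous.
  have c1 : cos (t * u) @[u --> (0 : R)] --> (1 : R).
    rewrite -[X in _ --> X](@cos0 R); apply: continuous_cvg => //.
    exact: continuous_cos.
  have c2 : sin (t * u) @[u --> (0 : R)] --> (0 : R).
    rewrite -[X in _ --> X](@sin0 R); apply: continuous_cvg => //.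
    exact: continuous_sin.
  have l0 : `|1 - 1 : R| + `|0 : R| = 0 by rewrite subrr normr0 addr0.
  rewrite -[X in _ --> X]l0; apply: cvgD; last exact: cvg_norm.
  by apply: cvg_norm; apply: cvgB => //; exact: cvg_cst.
have : \forall u \near (0 : R), `|cos (t * u) - 1| + `|sin (t * u)| <= d.
  exact: (cvgr_le _ c).
move=> /nbhs_ballP[h /= h0 hh].
exists (h / 2); rewrite ?divr_gt0// => x y xy.
have : `|cos (t * (x - y)) - 1| + `|sin (t * (x - y))| <= d.
  by apply: hh; rewrite /ball/= sub0r normrN; apply: le_lt_trans xy _; lra.
have -> : t * x = t * y + t * (x - y) by ring.
rewrite cosD sinD; set u := t * (x - y); set v := t * y => hd.
split; apply: le_trans hd.
  rewrite (_ : _ - _ = cos v * (cos u - 1) + - sin v * sin u); last by ring.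
  by apply: le_trans (ler_normD _ _) _; rewrite !normrM normrN lerD// ler_piMl// ?cos_max ?sin_max.
rewrite (_ : _ - _ = sin v * (cos u - 1) + cos v * sin u); last by ring.
by apply: le_trans (ler_normD _ _) _; rewrite !normrM lerD// ler_piMl// ?cos_max ?sin_max.
Qed.

Variable P : probability R R.
Hypotheses (idP : infinitely_divisible P) (sP : fsin P =1 (fun=> 0)).

Lemma power_exists (s : R) : 0 <= s -> exists Q, is_power P s Q.
Proof.
move=> s0.
(* Truncation makes [q k] approach s from below, within 2 / (k + 1). *)
pose m k := Num.truncn (s * k.+1%:R / 2).
pose q k : R := 2 * (m k)%:R / k.+1%:R.
have qs k : s - 2 / k.+1%:R <= q k <= s.
  have := @truncn_itv _ (s * k.+1%:R / 2) (divr_ge0 (mulr_ge0 s0 (ler0n _ _)) (ler0n _ _)).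
  rewrite -/(m k) => /andP[h1 h2]; rewrite /q ler_pdivrMr// ler_pdivlMr//.
  rewrite mulrBl divfK//; move: h2; rewrite -[(m k).+1%:R]natr1 => h2.
  by apply/andP; split; lra.
have qcvg : q k @[k --> \oo] --> s.
  apply: (@squeeze_cvgr _ _ _ _ (fun k => s - 2 / k.+1%:R) (fun=> s)).
  - exact: nearW.
  - rewrite -[X in _ --> X]subr0 -(mulr0 2); apply: cvgB; first exact: cvg_cst.
    by apply: cvgM; [exact: cvg_cst|exact: cvg_harmonic].
  - exact: cvg_cst.
have /boolp.choice[lam hlam] : forall k, exists Q, is_power P (q k) Q.
  by move=> k; exact: (rational_power idP sP (m k) (ltn0Sn k)).
pose N := (Num.truncn s).+1.
have sN : s < N%:R by exact: truncnS_gt.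
(* [kap] is the power 2 N. As q k <= s < N, the complementary exponent 2 N - q k is again of the
   form 2 m / n, so every [lam k] is a convolution factor of [kap] and inherits its tail bound. *)
have [kap [sk ck]] := rational_power idP sP N (ltn0Sn 0).
have tail k a : fine (lam k (far a)) <= 2 * fine (kap (far a)).
  have [slk clk] := hlam k.
  have mN : (m k <= N * k.+1)%N.
    rewrite -(ler_nat R) natrM; have /andP[_] := qs k.
    rewrite /q ler_pdivrMr//.
    have : s * k.+1%:R <= N%:R * k.+1%:R by rewrite ler_wpM2r// ltW.
    by have : (0 : R) <= (m k)%:R by []; lra.
  have [nu [sn cn]] := rational_power idP sP (N * k.+1 - m k) (ltn0Sn k).
  apply: (symmetric_far_le (nu := nu)) => // t.
  rewrite ck clk cn -expRD; congr expR.
  rewrite natrB// natrM /q; field.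
  by rewrite addrC natr1 pnatr_eq0.
have tight e : 0 < e -> exists M, forall k,
    1 - (dfun (lam k) M - dfun (lam k) (- M)) <= e.
  move=> e0; have [n _ /(_ n (leqnn n))/= hn] :=
    cvgr_le _ (@far_cvg0 kap) (e / 2) (divr_gt0 e0 (ltr0n _ 2)).
  exists n%:R => k; apply: le_trans (dfun_far _ (ler0n _ _)) _.
  by apply: le_trans (tail k _) _; lra.
have [U [UU ooU]] := @ultraFilterLemma _ \oo _.
have [Q hQ] := @weak_ultra_limit R lam tight U UU.
have PU : ProperFilter U := ultra_proper.
(* The ultrafilter refines [\oo], so ordinary limits persist and identify the characteristic
   function. *)
have toU (u : nat -> R) l : u @ \oo --> l -> u @ U --> l.
  by move=> ul A /ul /ooU.
exists Q; split => t.
- have c : \int[lam k]_x sin (t * x) @[k --> U] --> \int[Q]_x sin (t * x).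
    apply: hQ; [exact: measurable_sinM|by move=> x; exact: sin_max|].
    move=> d /(uniformly_continuous_trig t)[h h0 hh]; exists h => // x y /hh[].
    by [].
  apply: (cvg_unique _ c) => //.
  rewrite (_ : (fun k => _) = cst 0); first exact: cvg_cst.
  by apply/funext => k; have [+ _] := hlam k; apply.
- have c : \int[lam k]_x cos (t * x) @[k --> U] --> \int[Q]_x cos (t * x).
    apply: hQ; [exact: measurable_cosM|by move=> x; exact: cos_max|].
    move=> d /(uniformly_continuous_trig t)[h h0 hh]; exists h => // x y /hh[].
    by [].
  apply: (cvg_unique _ c) => //; apply: toU.
  rewrite (_ : (fun k => _) = (fun k => expR (- (q k * psi P t)))).
    apply: continuous_cvg; first exact: continuous_expR.
    by apply: cvgN; apply: cvgM => //; exact: cvg_cst.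
  by apply/funext => k; have [_] := hlam k; apply.
Qed.

End RealPowers.

(** * Injectivity *)

Section ConvolutionPowers.
Context {R : realType}.
Variable P : probability R R.
Hypotheses (idP : infinitely_divisible P) (sP : fsin P =1 (fun=> 0)).

(* The imaginary part of a continuous exponent has vanishing sine and starts
   at 0, so the intermediate value theorem keeps it at 0. *)
Lemma char_exponent_psi phi : char_exponent P phi ->
  forall t, complex.Re (phi t) = - psi P t /\ complex.Im (phi t) = 0.
Proof.
move=> [_ [cI [phi0 ephi]]].
have reE t : expR (complex.Re (phi t)) * cos (complex.Im (phi t)) = fcos P t.
  exact: (congr1 (@complex.Re R) (ephi t)).
have imE t : sin (complex.Im (phi t)) = 0.
  have := congr1 (@complex.Im R) (ephi t); rewrite /= -/(fsin P t) => e.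
  have : expR (complex.Re (phi t)) * sin (complex.Im (phi t)) = 0.
    by apply: etrans e _; exact: sP.
  by move/eqP; rewrite mulf_eq0 expR_eq0/= => /eqP.
have Im0 t : complex.Im (phi t) = 0.
  apply/eqP; apply/negPn/negP => It.
  pose I u := `|complex.Im (phi u)|.
  have cI' : continuous I by move=> u; apply: cvg_norm; exact: cI.
  (* Capped at 1 so that [v] lies in (0, 2), where the sine is positive. *)
  pose v := Num.min (I t) 1.
  have v0 : 0 < v by rewrite lt_min normr_gt0 It ltr01.
  have I0 : I 0 = 0 by rewrite /I phi0 normr0.
  have vI : v <= I t by rewrite /v ge_min lexx.
  have [c Ic] : exists c, I c = v.
    have [t0|t0] := leP 0 t.
      have [c _ <-] : exists2 c, c \in `[0, t] & I c = v.
        apply: IVT => //; first exact/continuous_subspaceT.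
        by rewrite I0 ge_min le_max vI (ltW v0) orbT.
      by exists c.
    have [c _ <-] : exists2 c, c \in `[t, 0] & I c = v.
      apply: IVT; first exact: ltW.
        exact/continuous_subspaceT.
      by rewrite I0 ge_min le_max vI (ltW v0) orbT.
    by exists c.
  have : 0 < sin v.
    by apply: sin2_gt0; rewrite v0/= gt_min; apply/orP; right; lra.
  rewrite -Ic /I; have [_|_] := ger0P (complex.Im (phi c)).
    by rewrite imE ltxx.
  by rewrite sinN imE oppr0 ltxx.
move=> t; split => //.
by rewrite /psi opprK -reE Im0 cos0 mulr1 expRK.
Qed.

Lemma char_exponent_exists : char_exponent P (fun t => ((- psi P t) +i* 0)%C).
Proof.
split; [|split; [|split]].
- by move=> t /=; apply: cvgN; exact: continuous_psi.
- by move=> t /=; exact: cvg_cst.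
- by rewrite psi0 oppr0.
- move=> t; rewrite /expC /= cos0 sin0 mulr1 mulr0 expR_psi// charfunE.
  by rewrite sP.
Qed.

Lemma expC_scale (s a : R) : expC (s%:C * (a +i* 0))%C = (expR (s * a) +i* 0)%C.
Proof. by rewrite /expC /= !mulr0 !mul0r subr0 addr0 cos0 sin0 mulr1 mulr0. Qed.

(** [is_mpow] quantifies over continuous exponents; here - psi is the only one, so the existential
    disappears. *)
Lemma is_mpowP s (Q : probability R R) : is_mpow P s Q <-> is_power P s Q.
Proof.
split.
- move=> [phi [cphi ephi]].
  have phiE t : phi t = ((- psi P t) +i* 0)%C.
    by have [] := char_exponent_psi cphi t; case: (phi t) => x y /= -> ->.
  have e t : charfun Q t = (expR (- (s * psi P t)) +i* 0)%C.
    by rewrite ephi phiE expC_scale mulrN.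
  split => t; first exact: (congr1 (@complex.Im R) (e t)).
  exact: (congr1 (@complex.Re R) (e t)).
- move=> [sQ cQ]; exists (fun t => ((- psi P t) +i* 0)%C).
  split; first exact: char_exponent_exists.
  by move=> t; rewrite expC_scale charfunE sQ cQ (mulrN s (psi P t)).

Qed.

Lemma mpow_power s : 0 <= s -> exists Q, is_power P s Q /\ mpow P s = Q.
Proof.
move=> s0; rewrite /mpow; case: pselect => [h|nh].
  exists (projT1 (cid h)); split => //; apply/is_mpowP.
  exact: (projT2 (cid h)).
(* Existence rules out the default value 0 of [mpow]. *)
have [Q hQ] := power_exists idP sP s0.
by exfalso; apply: nh; exists Q; apply/is_mpowP.
Qed.

End ConvolutionPowers.

Section PhiIntegrals.
Context {R : realType}.
Local Notation D := (`[0%R, +oo[%classic : set R).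
Local Open Scope ereal_scope.

Import HBNNSimple.

(** The mixtures are known to agree only on sets that miss 0. As g vanishes at 0, so do its simple
    approximations from below, and their nonzero level sets miss 0; the level 0 contributes
    nothing. *)
Lemma kernel_integral_eq (nu : R -> probability R R)
    (rho rho' : {measure set R -> \bar R}) (g : R -> R) :
  (forall A : set R, measurable A -> measurable_fun D (fun s => nu s A)) ->
  (forall A : set R, measurable A -> ~ A 0%R ->
    \int[rho]_(s in D) nu s A = \int[rho']_(s in D) nu s A) ->
  measurable_fun [set: R] g -> (forall x, (0 <= g x)%R) -> g 0%R = 0%R ->
  \int[rho]_(s in D) (\int[nu s]_x (g x)%:E) =
  \int[rho']_(s in D) (\int[nu s]_x (g x)%:E).
Proof.
move=> mnu eA mg g0 gz.
have mD : measurable D by exact: itvcy_measurable.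
have mgE : measurable_fun [set: R] (EFin \o g) by exact/measurable_EFinP.
have gE0 x : [set: R] x -> 0 <= (EFin \o g) x by move=> _ /=; rewrite lee_fin.
pose h := nnsfun_approx measurableT mgE.
have hg x : EFin \o h ^~ x @ \oo --> (g x)%:E.
  exact: (cvg_nnsfun_approx measurableT mgE gE0 (x := x) I).
have hnd : nondecreasing_seq (h : nat -> R -> R).
  by move=> n m nm; exact: nd_nnsfun_approx.
have h00 n : h n 0%R = 0%R.
  apply/le_anti/andP; split; last exact: fun_ge0.
  have hr : h k 0%R @[k --> \oo] --> (0 : R)%R.
    by have := hg 0%R; rewrite gz => /fine_cvg.
  apply: (cvgr_to_ge hr); exists n => // k /= nk.
  by have /lefP := hnd _ _ nk; exact.
have mpre n y : measurable (h n @^-1` [set y]).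
  by rewrite -[_ @^-1` _]setTI; apply: measurable_funPT.
have inner n s : \int[nu s]_x (h n x)%:E =
    \sum_(y \in range (h n)) (y%:E * nu s (h n @^-1` [set y])).
  by rewrite integralT_nnsfun sintegralE.
have term0 n y s : 0 <= y%:E * nu s (h n @^-1` [set y]).
  have [y0|y0] := leP 0%R y; first by rewrite mule_ge0.
  rewrite (_ : _ @^-1` _ = set0) ?measure0 ?mule0//.
  by rewrite -subset0 => x /= hx; move: y0; rewrite -hx ltNge fun_ge0.
have mterm n y : measurable_fun D (fun s => y%:E * nu s (h n @^-1` [set y])).
  by apply: measurable_funeM; exact: mnu.
have outer (m : {measure set R -> \bar R}) n :
    \int[m]_(s in D) (\int[nu s]_x (h n x)%:E) =
    \sum_(y \in range (h n)) (y%:E * \int[m]_(s in D) nu s (h n @^-1` [set y])).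
  under eq_integral do rewrite inner.
  rewrite ge0_integral_fsum//.
  apply: eq_fsbigr => y; rewrite inE => -[x _ <-].
  rewrite ge0_integralZl//; [exact: mnu|by rewrite lee_fin fun_ge0].
have limE (m : {measure set R -> \bar R}) :
    \int[m]_(s in D) (\int[nu s]_x (h n x)%:E) @[n --> \oo] -->
    \int[m]_(s in D) (\int[nu s]_x (g x)%:E).
  apply: cvg_nondecreasing_integral => //.
  - move=> n; apply: (eq_measurable_fun (fun s =>
      \sum_(y \in range (h n)) (y%:E * nu s (h n @^-1` [set y])))).
      by move=> s _; rewrite inner.
    by apply: emeasurable_fsum.
  - by move=> n s _; apply: integral_ge0 => x _; rewrite lee_fin fun_ge0.
  - move=> s _ n k nk; apply: ge0_le_integral => //.
    + by move=> x _; rewrite lee_fin fun_ge0.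
    + exact/measurable_EFinP.
    + exact/measurable_EFinP.
    + by move=> x _; rewrite lee_fin; apply/lefP/hnd.
  - move=> s _; apply: cvg_nondecreasing_integral => //.
    + by move=> n; exact/measurable_EFinP.
    + by move=> n x _; rewrite lee_fin fun_ge0.
    + by move=> x _ n k nk; rewrite lee_fin; apply/lefP/hnd.
    + by move=> x _; exact: hg.
have := limE rho.
rewrite (_ : (fun n => _) = (fun n => \int[rho']_(s in D) (\int[nu s]_x (h n x)%:E))).
  by move/cvg_unique; apply => //; exact: limE.
apply/funext => n; rewrite !outer; apply: eq_fsbigr => y _.
have [->|y0] := eqVneq y 0%R; first by rewrite !mul0e.
by rewrite eA//= h00 => /esym/eqP; apply/negP.
Qed.

End PhiIntegrals.

Lemma measurable_expRNM (R : realType) (c : R) (D : set R) :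
  measurable_fun D (fun s : R => expR (- (s * c))).
Proof.
apply: measurable_funTS; apply: measurableT_comp => //.
by apply: measurableT_comp => //; apply: measurable_funM.
Qed.

(** If psi vanished on the half-line it would vanish everywhere by evenness, and mu would have the
    characteristic function 1 of the Dirac mass at 0. *)
Lemma nondirac_psi (R : realType) (mu : probability R R) :
  infinitely_divisible mu -> fsin mu =1 (fun=> 0) -> ~ is_dirac mu ->
  exists2 t, 0 <= t & 0 < psi mu t.
Proof.
move=> idmu smu nd; apply: contrapT => npsi; apply: nd.
have [P [dP cP sP]] := @dirac_charfun R; exists 0 => A mA.
rewrite -dP//; apply: fcos_fsin_eq => // t; last by rewrite smu sP.
rewrite cP -fcos_abs -expR_psi// (_ : psi mu `|t| = 0) ?oppr0 ?expR0//.
apply/le_anti; rewrite psi_ge0 andbT leNgt; apply/negP => psit.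
by apply: npsi; exists `|t|.
Qed.

Theorem theorem3p2 (R : realType) (mu : probability R R)
  (mu_ID : infinitely_divisible mu) (mu_sym : symmetric_law mu)
  (mu_nondirac : ~ is_dirac mu)
  (rho rho' : {measure set R -> \bar R})
  (hrho : levy_domain rho) (hrho' : levy_domain rho')
  (hPhi : forall A : set R, measurable A -> Phi mu rho A = Phi mu rho' A) :
  forall A : set R, measurable A -> rho A = rho' A.
Proof.
have smu := symmetric_fsin mu_sym.
have mD : measurable (`[0, +oo[%classic : set R) by exact: itvcy_measurable.
have /boolp.choice[nu hnu] : forall s : R, exists Q,
    0 <= s -> is_power mu s Q /\ mpow mu s = Q.
  (* For s < 0 the value [mu] is arbitrary: all integrals run over s >= 0. *)
  move=> s; have [s0|s0] := leP 0 s; last by exists mu.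
  by have [Q hQ] := mpow_power mu_ID smu s0; exists Q.
have mnu (A : set R) : measurable A ->
    measurable_fun (`[0, +oo[%classic : set R) (fun s => nu s A).
  apply: measurable_kernel_trig => // t.
    apply: (eq_measurable_fun (fun s : R => expR (- (s * psi mu t)))).
      move=> s; rewrite inE/= in_itv/= andbT => /hnu[[_ c] _].
      exact: (esym (c t)).
    exact: measurable_expRNM.
  apply: (eq_measurable_fun (fun=> 0 : R)); last exact: measurable_cst.
  move=> s; rewrite inE/= in_itv/= andbT => /hnu[[c _] _].
  exact: (esym (c t)).
have eA (A : set R) : measurable A -> ~ A 0 ->
    (\int[rho]_(s in `[0%R, +oo[) nu s A = \int[rho']_(s in `[0%R, +oo[) nu s A)%E.
  move=> mA A0; have PhiE (m : {measure set R -> \bar R}) :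
      (Phi mu m A = \int[m]_(s in `[0%R, +oo[) nu s A)%E.
    apply: eq_integral => s; rewrite inE/= in_itv/= andbT => /hnu[_ ->].
    congr (nu s _); apply/seteqP; split => x /=; first by case.
    by move=> Ax; split => // x0; apply: A0; rewrite -x0.
  by rewrite -!PhiE hPhi.
have ept t : \int[rho]_(s in `[0, +oo[) (1 - expR (- (s * psi mu t))) =
             \int[rho']_(s in `[0, +oo[) (1 - expR (- (s * psi mu t))).
  have innerE (m : {measure set R -> \bar R}) :
      (\int[m]_(s in `[0%R, +oo[) (1 - expR (- (s * psi mu t)))%:E =
      \int[m]_(s in `[0%R, +oo[) (\int[nu s]_x (1 - cos (t * x))%:E))%E.
    apply: eq_integral => s; rewrite inE/= in_itv/= andbT => /hnu[[_ c] _].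
    (* 1 - exp (- s psi t) is the [nu s]-integral of 1 - cos (t x), whose integrand vanishes at x =
       0 as [kernel_integral_eq] requires. *)
    have one : (nu s).-integrable [set: R] (EFin \o cst 1) := integrable_one (nu s).
    rewrite -c -[in LHS](Rintegral_probability_cst (nu s) 1) -RintegralB//.
      rewrite /Rintegral fineK//; apply: integrable_fin_num => //.
      exact: (integrableB measurableT one (integrable_cosM (nu s) t)).
    exact: integrable_cosM.
  rewrite /Rintegral !innerE; congr fine.
  have g0 x : 0 <= 1 - cos (t * x) by rewrite subr_ge0 cos_le1.
  have gz : 1 - cos (t * 0) = 0 :> R by rewrite mulr0 cos0 subrr.
  have mg : measurable_fun [set: R] (fun x => 1 - cos (t * x)).
    by apply: measurable_funB => //; exact: measurable_cosM.
  exact: (kernel_integral_eq mnu eA mg g0 gz).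
have [t t0 psit] := nondirac_psi mu_ID smu mu_nondirac.
apply: (laplace_exponent_inj hrho hrho' psit) => b /andP[b0 bt].
have [u _ <-] : exists2 u, u \in `[0, t] & psi mu u = b; last exact: ept.
apply: IVT => //; first exact/continuous_subspaceT/continuous_psi.
by rewrite psi0 ge_min le_max b0 bt orbT.
Qed.
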